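(* Assume that $\mathbb{E}[\|N\|_2^2+\|\Lambda^{\mathsf T}\Lambda\|_2^2]<\infty$ and that $\mathbb{E}[N]$ is positive definite. Let $(Q_t)_{t\ge 0}$ be the Q-learning sequence $$Q_{t+1}=Q_t+\alpha_t\big(N_{t+1}+\Lambda_{t+1}^{\mathsf T}\Pi(Q_t)\Lambda_{t+1}-Q_t\big),\quad t=0,1,2,\dots,$$ with initial matrix $Q_0\in\mathbb{S}_+^d$. Then the probability that $(Q_t)_{t\ge0}$ is bounded is either $0$ or $1$.
   Context: Let $n,m\ge1$ be integers and $d=n+m$. $\mathbb{S}_+^d$ is the set of real symmetric positive semidefinite $d\times d$ matrices, and $\|\cdot\|_2$ is the matrix $2$-norm. For $P\in\mathbb{S}_+^d$ write $P=\begin{bmatrix}P_{xx}&P_{xu}\\P_{ux}&P_{uu}\end{bmatrix}$ with $P_{xx}\in\mathbb{R}^{n\times n}$, and define $\Pi(P)=P_{xx}-P_{xu}P_{uu}^{+}P_{ux}$, where $P_{uu}^+$ is the Moore--Penrose pseudoinverse. On a probability space $(\Omega,\mathcal F,\mathbb P)$ let $(\Lambda_t,N_t)$, $t=1,2,\dots$, be independent and identically distributed random pairs with $\Lambda_t\in\mathbb{R}^{n\times d}$ and $N_t\in\mathbb{S}_+^d$; $(\Lambda,N)$ denotes an independent copy of $(\Lambda_1,N_1)$. Let $\mathcal F_0=\{\varnothing,\Omega\}$ and $\mathcal F_t=\sigma\{\Lambda_s,N_s:s=1,\dots,t\}$. The learning rates $\alpha_t\in[0,1]$, $t=0,1,\dots$,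 may be random, with $\alpha_t$ being $\mathcal F_t$-measurable, and satisfy $\sum_{t}\alpha_t=\infty$ and $\sum_t\alpha_t^2<\infty$ (almost surely). The initial matrix $Q_0$ is deterministic. *)

(* Defs.v *)
From HB Require Import structures.
From mathcomp Require Import all_boot all_order all_algebra.
From mathcomp Require Import finmap all_classical all_reals all_analysis.
Import Order.TTheory GRing.Theory Num.Theory.
Import numFieldNormedType.Exports.

Set Implicit Arguments.
Unset Strict Implicit.
Unset Printing Implicit Defensive.

Local Open Scope classical_set_scope.
Local Open Scope ring_scope.

Definition psdmx (R : realType) (d : nat) (A : 'M[R]_d) : Prop :=
  A^T = A /\ forall x : 'cV[R]_d, 0 <= (x^T *m A *m x) 0 0.

Definition pdmx (R : realType) (d : nat) (A : 'M[R]_d) : Prop :=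
  A^T = A /\ forall x : 'cV[R]_d, x != 0 -> 0 < (x^T *m A *m x) 0 0.

Definition enorm (R : realType) (d : nat) (x : 'cV[R]_d) : R :=
  Num.sqrt (\sum_i x i 0 ^+ 2).

(* The library's norm on matrices is the entrywise maximum, not this one. *)
Definition mxnorm2 (R : realType) (p q : nat) (A : 'M[R]_(p, q)) : R :=
  sup [set enorm (A *m x) | x in [set x : 'cV[R]_q | enorm x <= 1]].

(* [pinvmx] from mxalgebra is only a generalized inverse, so the Moore-Penrose
   pseudoinverse is introduced through the four Penrose equations. *)
Definition penrose (R : realType) (p q : nat)
    (A : 'M[R]_(p, q)) (X : 'M[R]_(q, p)) : Prop :=
  [/\ A *m X *m A = A, X *m A *m X = X,
      (A *m X)^T = A *m X & (X *m A)^T = X *m A].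

Definition mppinv (R : realType) (p q : nat) (A : 'M[R]_(p, q)) : 'M[R]_(q, p) :=
  xget 0 [set X | penrose A X].

Lemma penrose_uniq (R : realType) (p q : nat) (A : 'M[R]_(p, q))
    (X Y : 'M[R]_(q, p)) : penrose A X -> penrose A Y -> X = Y.
Proof.
move=> [aX xX sX tX] [aY yY sY tY].
have eAX : A *m X = A *m Y.
  by rewrite -[LHS]sX -{1}aY -(mulmxA (A *m Y)) trmx_mul sX sY mulmxA aX.
have eXA : X *m A = Y *m A.
  by rewrite -[LHS]tX -{1}aY !mulmxA -(mulmxA (X *m A)) trmx_mul tX tY
             mulmxA -(mulmxA Y) -(mulmxA Y) aX.
by rewrite -[LHS]xX -mulmxA eAX mulmxA eXA yY.
Qed.

Lemma gram_unit (R : realType) (p r : nat) (C : 'M[R]_(p, r)) :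
  \rank C = r -> C^T *m C \in unitmx.
Proof.
move=> rC; rewrite -row_free_unit; apply: inj_row_free => v vK.
have fC : row_free C^T by rewrite /row_free mxrank_tr rC.
apply: (row_free_inj fC); rewrite mul0mx.
have : (v *m C^T) *m (v *m C^T)^T = 0.
  by rewrite trmx_mul trmxK -mulmxA (mulmxA C^T) mulmxA vK mul0mx.
move/matrixP/(_ 0 0); rewrite !mxE => /eqP.
rewrite psumr_eq0 => [/allP h|i _]; last by rewrite !mxE -expr2 sqr_ge0.
apply/rowP => i; have := h i (mem_index_enum _).
by rewrite !mxE -expr2 sqrf_eq0 => /eqP.
Qed.

Lemma mppinvP (R : realType) (p q : nat) (A : 'M[R]_(p, q)) :
  penrose A (mppinv A).
Proof.
suff [X hX] : exists X, penrose A X by rewrite /mppinv; case: xgetP => // /(_ X).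
have rB : \rank (row_base A)^T = \rank A.
  by rewrite mxrank_tr; apply/eqP; exact: row_base_free.
have rC : \rank (col_base A) = \rank A by apply/eqP; exact: col_base_full.
have := mulmx_base A; move: (col_base A) (row_base A) rC rB.
move: (\rank A) => r C B /gram_unit uC /gram_unit; rewrite trmxK => uB.
move/esym => AE.
pose K := invmx (C^T *m C); pose L := invmx (B *m B^T).
have KT : K^T = K by rewrite /K trmx_inv trmx_mul trmxK.
have LT : L^T = L by rewrite /L trmx_inv trmx_mul trmxK.
exists (B^T *m L *m K *m C^T).
have AX : A *m (B^T *m L *m K *m C^T) = C *m K *m C^T.
  by rewrite AE !mulmxA -(mulmxA C B) -(mulmxA C _ L) mulmxV // mulmx1.
have XA : B^T *m L *m K *m C^T *m A = B^T *m L *m B.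
  by rewrite AE !mulmxA -(mulmxA _ C^T) -(mulmxA _ K) mulVmx // mulmx1.
split; rewrite ?AX ?XA.
- by rewrite AE !mulmxA -(mulmxA _ C^T) -(mulmxA _ K) mulVmx // mulmx1.
- by rewrite !mulmxA -(mulmxA _ B) -(mulmxA _ _ L) mulmxV // mulmx1.
- by rewrite !trmx_mul trmxK KT mulmxA.
- by rewrite !trmx_mul trmxK LT mulmxA.
Qed.

Definition Pi (R : realType) (n m : nat) (P : 'M[R]_(n + m)) : 'M[R]_n :=
  ulsubmx P - ursubmx P *m mppinv (drsubmx P) *m dlsubmx P.

(* Matrices with their Borel sigma-algebra; a pair of such types carries the
   product sigma-algebra. *)
Definition borelmx (R : realType) (p q : nat) :=
  g_sigma_algebraType (@open 'M[R]_(p, q)).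

HB.instance Definition _ (R : realType) (p q : nat) :=
  Measurable.on (borelmx R p q).

Definition obs (R : realType) (n m : nat) (T : Type)
    (Lam : nat -> T -> 'M[R]_(n, n + m)) (N : nat -> T -> 'M[R]_(n + m))
    (t : nat) (w : T) : borelmx R n (n + m) * borelmx R (n + m) (n + m) :=
  (Lam t w, N t w).

Definition mutually_independent d (T : measurableType d) (R : realType)
    (P : probability T R) d' (S : measurableType d') (I : set nat)
    (X : nat -> T -> S) : Prop :=
  forall (J : {fset nat}) (E : nat -> set T),
    (forall t, t \in J -> I t /\ g_sigma_algebra_preimage (X t) (E t)) ->
    P (\bigcap_(t in [set` J]) E t) = (\prod_(t <- J) P (E t))%E.

Definition identically_distributed d (T : measurableType d) (R : realType)
    (P : probability T R) d' (S : measurableType d') (I : set nat)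
    (X : nat -> T -> S) : Prop :=
  forall s t, I s -> I t ->
    forall B, measurable B -> P (X s @^-1` B) = P (X t @^-1` B).

(* Observations are numbered from 1, so entry 0 of [X] is not observed and the
   sigma-algebra at time 0 is trivial. *)
Definition filtration d (T : measurableType d) d' (S : measurableType d')
    (X : nat -> T -> S) (t : nat) : set (set T) :=
  <<s \bigcup_(s in [set s | (1 <= s <= t)%N]) g_sigma_algebra_preimage (X s) >>.

Definition meanmx d (T : measurableType d) (R : realType) (P : probability T R)
    (p q : nat) (X : T -> 'M[R]_(p, q)) : 'M[R]_(p, q) :=
  \matrix_(i, j) fine ('E_P[fun w => X w i j])%E.

(* Main.v *)
Require Import Defs.
From HB Require Import structures.
From mathcomp Require Import all_boot all_order all_algebra.
From mathcomp Require Import finmap all_classical all_reals all_analysis.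
From mathcomp Require Import measurable_realfun ring lra.
Import Order.TTheory GRing.Theory Num.Theory.
Import numFieldNormedType.Exports.

Set Implicit Arguments.
Unset Strict Implicit.
Unset Printing Implicit Defensive.

Local Open Scope classical_set_scope.
Local Open Scope ring_scope.

(** The probability that [Q] is bounded is decided by a deterministic condition:
    the existence of a supersolution, a semidefinite [P] with
    [E N / 2 + E (Lam^T Pi(P) Lam) <= P] in the Loewner order
    ([supersolution]).  If there is one, almost every path is bounded; if there
    is none, almost every path is unbounded.  The zero-one law for tail events
    does not apply, since the step sizes may depend on the whole past.

    Randomness enters only through the entries of [N] and the products of two
    entries of [Lam].  For each such variable [y], with mean [mu], the series of
    [alpha_t (y_(t+1) - mu)] converges almost surely ([compensated_ae]); this is
    the convergence of a square-integrable martingale, obtained from the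
    orthogonality of its increments ([martingale_square]), a maximal inequality
    ([maximal_inequality]) and a truncation of the step sizes.  On a path where
    these finitely many series converge and the step sizes have an infinite sum,
    the dichotomy is deterministic.

    A supersolution bounds the path ([supersolution_bounded]).  [Pi(Q)] is the
    minimum over feedback gains [K] of the cost [(1, K)^T Q (1, K)]
    ([Pi_le_feedback_cost]), so the gain that is optimal for the supersolution
    gives a linear recursion that dominates [Q].  The mean of its linear map is a
    contraction in the norm induced by the supersolution, and therefore has a
    linear Lyapunov functional [V] that is comparable with the trace on
    semidefinite matrices ([lyapunov_functional]).  The random part of the linear
    map is multiplied by the current state, but subtracting from [V] the tail of
    the convergent fluctuation series leaves a scalar recursion
    [z' <= (1 - c a + a l) z + a q] in which [l] has a small mean, and such
    recursions are bounded ([contraction_bounded]).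

    A bounded path yields a supersolution ([bounded_supersolution]).  Value
    iteration from [0] increases; since averages converge to means
    ([averages_cvg]) and [Pi] is monotone and superhomogeneous, [Q_t] eventually
    exceeds [s] times each iterate for each [s < 1]
    ([value_iteration_liminf]).  If [Q] is bounded, so are the iterates; then some
    increment is below [E N / 2], and at that stage the iterate is a
    supersolution.

    Finally, the event of boundedness is measurable, because on semidefinite
    matrices [Pi] is a pointwise limit of rational functions
    ([Pi_ridge_cvg]). *)

(** * The Loewner order *)

Section Loewner.
Context {R : realType}.

Definition qform d (A : 'M[R]_d) (x : 'cV[R]_d) : R := (x^T *m A *m x) 0 0.

Definition loewner_le d (A B : 'M[R]_d) : Prop := psdmx (B - A).

Lemma qformE d (A : 'M[R]_d) x :
  qform A x = \sum_i \sum_j x i 0 * A i j * x j 0.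
Proof.
rewrite /qform !mxE exchange_big /=; apply: eq_bigr => j _.
by rewrite !mxE mulr_suml; apply: eq_bigr => i _; rewrite !mxE.
Qed.

Lemma qformD d (A B : 'M[R]_d) x : qform (A + B) x = qform A x + qform B x.
Proof. by rewrite /qform mulmxDr mulmxDl mxE. Qed.

Lemma qformZ d c (A : 'M[R]_d) x : qform (c *: A) x = c * qform A x.
Proof. by rewrite /qform -scalemxAr -scalemxAl mxE. Qed.

Lemma qformN d (A : 'M[R]_d) x : qform (- A) x = - qform A x.
Proof. by rewrite -scaleN1r qformZ mulN1r. Qed.

Lemma qformB d (A B : 'M[R]_d) x : qform (A - B) x = qform A x - qform B x.
Proof. by rewrite qformD qformN. Qed.

Lemma qform_congr d e (A : 'M[R]_d) (C : 'M[R]_(d, e)) x :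
  qform (C^T *m A *m C) x = qform A (C *m x).
Proof. by rewrite /qform trmx_mul !mulmxA. Qed.

Lemma qform1 d (x : 'cV[R]_d) : qform 1%:M x = \sum_i x i 0 ^+ 2.
Proof.
by rewrite /qform mulmx1 mxE; apply: eq_bigr => i _; rewrite mxE expr2.
Qed.

Lemma psd_sym d (A : 'M[R]_d) : psdmx A -> A^T = A.
Proof. by case. Qed.

Lemma psd_qform d (A : 'M[R]_d) x : psdmx A -> 0 <= qform A x.
Proof. by case=> _ /(_ x). Qed.

Lemma psd0 d : psdmx (0 : 'M[R]_d).
Proof. by split=> [|x]; rewrite ?trmx0 // mulmx0 mul0mx mxE. Qed.

Lemma psdD d (A B : 'M[R]_d) : psdmx A -> psdmx B -> psdmx (A + B).
Proof.
move=> [sA pA] [sB pB]; split=> [|x]; first by rewrite linearD /= sA sB.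
by rewrite -/(qform _ _) qformD addr_ge0 ?pA ?pB.
Qed.

Lemma psdZ d c (A : 'M[R]_d) : 0 <= c -> psdmx A -> psdmx (c *: A).
Proof.
move=> c0 [sA pA]; split=> [|x]; first by rewrite linearZ /= sA.
by rewrite -/(qform _ _) qformZ mulr_ge0 ?pA.
Qed.

Lemma psd_congr d e (A : 'M[R]_d) (C : 'M[R]_(d, e)) :
  psdmx A -> psdmx (C^T *m A *m C).
Proof.
move=> [sA pA]; split=> [|x]; first by rewrite !trmx_mul trmxK sA mulmxA.
by rewrite -/(qform _ _) qform_congr pA.
Qed.

Lemma psd1 d : psdmx (1%:M : 'M[R]_d).
Proof.
split=> [|x]; first by rewrite trmx1.
by rewrite -/(qform _ _) qform1; apply: sumr_ge0 => i _; apply: sqr_ge0.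
Qed.

Lemma pd_psd d (A : 'M[R]_d) : pdmx A -> psdmx A.
Proof.
move=> [sA pA]; split=> // x; have [->|/pA/ltW //] := eqVneq x 0.
by rewrite mulmx0 mxE.
Qed.

Lemma loewner_refl d (A : 'M[R]_d) : loewner_le A A.
Proof. by rewrite /loewner_le subrr; apply: psd0. Qed.

Lemma loewner_trans d (B A C : 'M[R]_d) :
  loewner_le A B -> loewner_le B C -> loewner_le A C.
Proof. by rewrite /loewner_le => AB BC; rewrite -(subrKA B); apply: psdD. Qed.

Lemma loewner0 d (A : 'M[R]_d) : loewner_le 0 A <-> psdmx A.
Proof. by rewrite /loewner_le subr0. Qed.

Lemma loewnerD d (A B C D : 'M[R]_d) :
  loewner_le A B -> loewner_le C D -> loewner_le (A + C) (B + D).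
Proof. by rewrite /loewner_le opprD addrACA; apply: psdD. Qed.

Lemma loewnerZ d c (A B : 'M[R]_d) :
  0 <= c -> loewner_le A B -> loewner_le (c *: A) (c *: B).
Proof. by rewrite /loewner_le -scalerBr; apply: psdZ. Qed.

Lemma loewner_congr d e (A B : 'M[R]_d) (C : 'M[R]_(d, e)) :
  loewner_le A B -> loewner_le (C^T *m A *m C) (C^T *m B *m C).
Proof. by rewrite /loewner_le -mulmxBl -mulmxBr; apply: psd_congr. Qed.

Lemma loewner_qform d (A B : 'M[R]_d) x :
  loewner_le A B -> qform A x <= qform B x.
Proof. by move/psd_qform => /(_ x); rewrite qformB subr_ge0. Qed.

Lemma loewnerP d (A B : 'M[R]_d) : A^T = A -> B^T = B ->
  (forall x, qform A x <= qform B x) -> loewner_le A B.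
Proof.
move=> sA sB AB; split=> [|x]; first by rewrite linearB /= sA sB.
by rewrite -/(qform _ _) qformB subr_ge0.
Qed.

Lemma psd_ge d (A B : 'M[R]_d) : psdmx A -> loewner_le A B -> psdmx B.
Proof. by rewrite -!loewner0; apply: loewner_trans. Qed.

Lemma qform_delta d (A : 'M[R]_d) i j (c : R) :
  qform A (delta_mx i 0 + c *: delta_mx j 0) =
  A i i + c * A i j + c * A j i + c ^+ 2 * A j j.
Proof.
have E p q : ((delta_mx p 0 : 'cV_d)^T *m A *m (delta_mx q 0 : 'cV_d)) 0 0 = A p q.
  by rewrite trmx_delta -rowE -colE !mxE.
rewrite /qform [(_ + _)^T]linearD /= [(_ *: _)^T]linearZ /=.
rewrite !mulmxDl !mulmxDr.
rewrite -!scalemxAl -!scalemxAr.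
have D (M M' : 'M[R]_1) : (M + M') 0 0 = M 0 0 + M' 0 0 by rewrite mxE.
have Z a (M : 'M[R]_1) : (a *: M) 0 0 = a * M 0 0 by rewrite mxE.
by rewrite !(D, Z) !E; ring.
Qed.

Lemma psd_diag_ge0 d (A : 'M[R]_d) i : psdmx A -> 0 <= A i i.
Proof.
move/psd_qform => /(_ (delta_mx i 0 + 0 *: delta_mx i 0)).
by rewrite qform_delta expr0n /= !mul0r !addr0.
Qed.

Lemma psd_diag_le_tr d (A : 'M[R]_d) i : psdmx A -> A i i <= \tr A.
Proof.
move=> pA; rewrite /mxtrace (bigD1 i) //= lerDl.
by apply: sumr_ge0 => j _; apply: psd_diag_ge0.
Qed.

Lemma psd_tr_ge0 d (A : 'M[R]_d) : psdmx A -> 0 <= \tr A.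
Proof. by move=> pA; apply: sumr_ge0 => i _; apply: psd_diag_ge0. Qed.

Lemma loewner_tr d (A B : 'M[R]_d) : loewner_le A B -> \tr A <= \tr B.
Proof. by move/psd_tr_ge0; rewrite linearB /= subr_ge0. Qed.

(** The form is nonnegative at [e_i + e_j] and [e_i - e_j].  On semidefinite
    matrices the trace is thus a norm, and it is linear. *)
Lemma psd_entry_le_tr d (A : 'M[R]_d) i j : psdmx A -> `|A i j| <= \tr A.
Proof.
move=> pA; have sA : A j i = A i j by rewrite -{2}(psd_sym pA) mxE.
have := psd_qform (delta_mx i 0 + 1 *: delta_mx j 0) pA.
have := psd_qform (delta_mx i 0 + (-1) *: delta_mx j 0) pA.
rewrite !qform_delta sA sqrrN expr1n.
have := psd_diag_le_tr i pA; have := psd_diag_le_tr j pA.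
by rewrite ler_norml; lra.
Qed.

Lemma loewner_entries d (A : 'M[R]_d) e : A^T = A ->
  (forall i j, `|A i j| <= e) -> loewner_le A ((d%:R * e) *: 1%:M).
Proof.
move=> sA Ae; apply: loewnerP => // [|x]; first by rewrite linearZ /= trmx1.
rewrite qformZ qform1 qformE.
have -> : d%:R * e * \sum_i x i 0 ^+ 2 =
    \sum_i \sum_j e * ((x i 0 ^+ 2 + x j 0 ^+ 2) / 2).
  under [RHS]eq_bigr => i _.
    rewrite -mulr_sumr -mulr_suml big_split /= sumr_const card_ord.
    over.
  rewrite -mulr_sumr -mulr_suml big_split /= sumr_const card_ord.
  by rewrite sumrMnl -mulr_natr; field.
apply: ler_sum => i _; apply: ler_sum => j _.
have e0 : 0 <= e by apply: le_trans (Ae i j).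
have := Ae i j; rewrite ler_norml => /andP[h1 h2].
have h3 := sqr_ge0 (x i 0 - x j 0); have h4 := sqr_ge0 (x i 0 + x j 0).
have : 0 <= (e - A i j) * (x i 0 + x j 0) ^+ 2 by apply: mulr_ge0; lra.
have : 0 <= (e + A i j) * (x i 0 - x j 0) ^+ 2 by apply: mulr_ge0; lra.
lra.
Qed.

Lemma psd_le_tr d (A : 'M[R]_d) :
  psdmx A -> loewner_le A ((d%:R * \tr A) *: 1%:M).
Proof.
move=> pA; apply: loewner_entries; first exact: psd_sym.
by move=> i j; apply: psd_entry_le_tr.
Qed.

Lemma pd_unit d (A : 'M[R]_d) : pdmx A -> A \in unitmx.
Proof.
move=> [sA pA]; rewrite -row_free_unit; apply: inj_row_free => v vA.
apply/eqP; apply: contraT; rewrite -(inj_eq trmx_inj) trmx0 => /pA.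
by rewrite trmxK vA mul0mx mxE ltxx.
Qed.

(** The minimum over [s] of the form of [H] at [x - s H^-1 x] is nonnegative,
    and the form of [H^-1] is at most a multiple of the squared length. *)
Lemma pd_lower_bound d (H : 'M[R]_d) :
  pdmx H -> exists2 l : R, 0 < l & loewner_le (l *: 1%:M) H.
Proof.
move=> pdH; have uH := pd_unit pdH; have pH := pd_psd pdH.
pose K := invmx H.
have sK : K^T = K by rewrite /K trmx_inv (psd_sym pH).
pose e := \sum_i \sum_j `|K i j| + 1.
have e_gt0 : 0 < e.
  by rewrite ltr_wpDl //; apply: sumr_ge0 => i _; apply: sumr_ge0.
have Ke i j : `|K i j| <= e.
  rewrite /e (bigD1 i) //= (bigD1 j) //= -!addrA lerDl !addrA.
  by rewrite !addr_ge0 // !sumr_ge0 // => k _; rewrite sumr_ge0.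
have KI := loewner_entries sK Ke.
have {KI} KI : loewner_le K ((d.+1%:R * e) *: 1%:M).
  apply: loewner_trans KI _.
  rewrite /loewner_le -scalerBl -mulrBl -natrB // subSnn mul1r.
  by apply: psdZ; [exact: ltW|exact: psd1].
set mu := d.+1%:R * e in KI.
have mu_gt0 : 0 < mu by rewrite mulr_gt0 ?ltr0n.
exists mu^-1; first by rewrite invr_gt0.
apply: loewnerP; [by rewrite linearZ /= trmx1|exact: psd_sym|move=> x].
have := psd_qform (x + (- mu^-1) *: (K *m x)) pH.
have -> : qform H (x + (- mu^-1) *: (K *m x)) =
    qform H x - 2 * mu^-1 * qform 1%:M x + mu^-1 ^+ 2 * qform K x.
  rewrite /qform [(_ + _)^T]linearD /= [(_ *: _)^T]linearZ /= trmx_mul sK !mulmxDl !mulmxDr.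
  rewrite -!scalemxAl -!scalemxAr !mulmxA -(mulmxA x^T K H) mulVmx //.
  rewrite -(mulmxA x^T H K) mulmxV // !mulmx1.
  have D (M M' : 'M[R]_1) : (M + M') 0 0 = M 0 0 + M' 0 0 by rewrite mxE.
  have Z a (M : 'M[R]_1) : (a *: M) 0 0 = a * M 0 0 by rewrite mxE.
  by rewrite !(D, Z); ring.
have := loewner_qform x KI; rewrite !qformZ => h1 h2.
have : mu^-1 ^+ 2 * qform K x <= mu^-1 * qform 1%:M x.
  have -> : mu^-1 * qform 1%:M x = mu^-1 ^+ 2 * (mu * qform 1%:M x).
    by field; rewrite gt_eqF.
  by rewrite ler_wpM2l ?sqr_ge0.
lra.
Qed.

End Loewner.

(** * The generalized Schur complement as a least feedback cost *)

Section Schur.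
Context {R : realType}.

(** Otherwise the form would be affine and nonconstant along the line through
    [Q v] in the direction [v], hence negative somewhere. *)
Lemma psd_ker d (Q : 'M[R]_d) (v : 'cV[R]_d) :
  psdmx Q -> qform Q v = 0 -> Q *m v = 0.
Proof.
move=> pQ v0; set w := Q *m v.
pose c := \sum_i w i 0 ^+ 2.
have H s : 0 <= qform Q w + 2 * s * c.
  have := psd_qform (w + s *: v) pQ.
  suff -> : qform Q (w + s *: v) = qform Q w + 2 * s * c + s ^+ 2 * qform Q v.
    by rewrite v0 mulr0 addr0.
  have D (M M' : 'M[R]_1) : (M + M') 0 0 = M 0 0 + M' 0 0 by rewrite mxE.
  have Z a (M : 'M[R]_1) : (a *: M) 0 0 = a * M 0 0 by rewrite mxE.
  have cE : (w^T *m w) 0 0 = c.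
    by rewrite mxE; apply: eq_bigr => i _; rewrite mxE expr2.
  rewrite /qform [(_ + _)^T]linearD /= [(_ *: _)^T]linearZ /=.
  rewrite !mulmxDl !mulmxDr -!scalemxAl -!scalemxAr.
  have -> : v^T *m Q = w^T by rewrite /w trmx_mul (psd_sym pQ).
  by rewrite -(mulmxA w^T Q v) -/w !(D, Z) cE; ring.
have c_ge0 : 0 <= c by apply: sumr_ge0 => i _; apply: sqr_ge0.
have /eqP : c = 0.
  apply/eqP; apply: contraT => c0; have := H (- (qform Q w + 1) / (2 * c)).
  suff -> : 2 * (- (qform Q w + 1) / (2 * c)) * c = - (qform Q w + 1) by lra.
  by field; rewrite c0.
rewrite psumr_eq0 => [/allP h|i _]; last exact: sqr_ge0.
apply/colP => i; have := h i (mem_index_enum _).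
by rewrite /= sqrf_eq0 => /eqP ->; rewrite [RHS]mxE.
Qed.

Context {n m : nat}.
Implicit Types (Q : 'M[R]_(n + m)) (K : 'M[R]_(m, n)).

(** The matrix of the quadratic form that sends a state [x] to the value of [Q]
    at [(x, K x)]: the cost of the linear feedback [K]. *)
Definition feedback_cost K Q : 'M[R]_n :=
  (col_mx 1%:M K)^T *m Q *m col_mx 1%:M K.

Definition optimal_gain Q : 'M[R]_(m, n) :=
  - (mppinv (drsubmx Q) *m dlsubmx Q).

Lemma feedback_costE K Q :
  feedback_cost K Q = ulsubmx Q + ursubmx Q *m K + K^T *m dlsubmx Q
                      + K^T *m drsubmx Q *m K.
Proof.
rewrite /feedback_cost -{1}(submxK Q) tr_col_mx trmx1 mul_row_block.
by rewrite !mul1mx mul_row_col mulmx1 mulmxDl !addrA (addrAC (ulsubmx Q)).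
Qed.

Lemma psd_dr Q : psdmx Q -> psdmx (drsubmx Q).
Proof.
move=> /(psd_congr (col_mx 0 1%:M : 'M[R]_(n + m, m))).
rewrite -{1}(submxK Q) tr_col_mx trmx0 trmx1 mul_row_block.
by rewrite !mul1mx !mul0mx !add0r mul_row_col mulmx1 mulmx0 add0r.
Qed.

Lemma psd_ur Q : psdmx Q -> ursubmx Q = (dlsubmx Q)^T.
Proof. by move=> /psd_sym sQ; rewrite trmx_dlsub sQ. Qed.

(** The kernel of the control block of a semidefinite matrix annihilates the
    cross block, so the columns of the cross block lie in its range. *)
Lemma psd_range Q : psdmx Q ->
  drsubmx Q *m mppinv (drsubmx Q) *m dlsubmx Q = dlsubmx Q.
Proof.
move=> pQ; set D := drsubmx Q; set X := mppinv D; set B := dlsubmx Q.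
have [DXD _ _ _] : penrose D X by exact: mppinvP.
have sD : D^T = D by exact/psd_sym/psd_dr.
pose U := 1%:M - X *m D.
have DU : D *m U = 0 by rewrite mulmxBr mulmx1 mulmxA DXD subrr.
have colM (M : 'M[R]_m) j : M *m col j U = col j (M *m U).
  by rewrite !colE mulmxA.
have colMB j : B^T *m col j U = col j (B^T *m U) by rewrite !colE mulmxA.
have BU : B^T *m U = 0.
  apply/matrixP => i j; rewrite mxE.
  have /(psd_ker pQ) : qform Q (col_mx 0 (col j U)) = 0.
    rewrite /qform -(submxK Q) tr_col_mx trmx0 mul_row_block !mul0mx !add0r.
    rewrite mul_row_col mulmx0 add0r -mulmxA -/D.
    by rewrite colM DU col0 mulmx0 mxE.
  rewrite -(submxK Q) mul_block_col !mulmx0 !add0r -col_mx0.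
  by move=> /eq_col_mx[/matrixP/(_ i 0)]; rewrite psd_ur // -/B colMB !mxE.
have BE : B = D *m X^T *m B.
  move/eqP: BU; rewrite mulmxBr mulmx1 subr_eq0 => /eqP/(congr1 trmx).
  by rewrite !trmx_mul trmxK sD.
by rewrite [X in _ *m X = _]BE !mulmxA DXD -BE.
Qed.

(** Completing the square in the control variable. *)
Lemma feedback_cost_square K Q : psdmx Q ->
  feedback_cost K Q = Pi Q + (K - optimal_gain Q)^T *m drsubmx Q
                               *m (K - optimal_gain Q).
Proof.
move=> pQ; rewrite feedback_costE /Pi /optimal_gain opprK psd_ur //.
have := psd_range pQ; have := psd_sym (psd_dr pQ).
move: (ulsubmx Q) (dlsubmx Q) (drsubmx Q) (mppinv _) => A B D X sD DXB.
have BXD : B^T *m X^T *m D = B^T.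
  by rewrite -[RHS](congr1 trmx DXB) !trmx_mul sD mulmxA.
have -> : (K + X *m B)^T *m D *m (K + X *m B) =
    K^T *m D *m K + K^T *m B + (B^T *m K + B^T *m X *m B).
  rewrite [(_ + _)^T]linearD /= trmx_mul mulmxDl BXD mulmxDl !mulmxDr !mulmxA.
  by rewrite -(mulmxA K^T D X) -(mulmxA K^T (D *m X) B) DXB.
move: (K^T *m D *m K) (K^T *m B) (B^T *m K) (B^T *m X *m B).
by move=> a b c e; apply/matrixP => i j; rewrite !mxE; ring.
Qed.

Lemma feedback_cost_optimal Q : psdmx Q ->
  feedback_cost (optimal_gain Q) Q = Pi Q.
Proof. by move=> pQ; rewrite feedback_cost_square // subrr mulmx0 addr0. Qed.

(** [Pi Q] is the least cost over all feedback gains.  Monotonicity and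
    superhomogeneity of [Pi] follow from this alone. *)
Lemma Pi_le_feedback_cost K Q :
  psdmx Q -> loewner_le (Pi Q) (feedback_cost K Q).
Proof.
move=> pQ; rewrite /loewner_le feedback_cost_square // addrAC subrr add0r.
exact/psd_congr/psd_dr.
Qed.

Lemma psd_feedback_cost K Q : psdmx Q -> psdmx (feedback_cost K Q).
Proof. exact: psd_congr. Qed.

Lemma psd_Pi Q : psdmx Q -> psdmx (Pi Q).
Proof.
by move=> pQ; rewrite -feedback_cost_optimal //; apply: psd_feedback_cost.
Qed.

Lemma loewner_feedback_cost K Q Q' :
  loewner_le Q Q' -> loewner_le (feedback_cost K Q) (feedback_cost K Q').
Proof. exact: loewner_congr. Qed.

Lemma loewner_Pi Q Q' :
  psdmx Q -> loewner_le Q Q' -> loewner_le (Pi Q) (Pi Q').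
Proof.
move=> pQ QQ'; rewrite -(feedback_cost_optimal (psd_ge pQ QQ')).
exact: loewner_trans (Pi_le_feedback_cost _ pQ) (loewner_feedback_cost _ QQ').
Qed.

Lemma feedback_costZ K c Q : feedback_cost K (c *: Q) = c *: feedback_cost K Q.
Proof. by rewrite /feedback_cost -scalemxAr -scalemxAl. Qed.

Lemma feedback_costD K Q Q' :
  feedback_cost K (Q + Q') = feedback_cost K Q + feedback_cost K Q'.
Proof. by rewrite /feedback_cost mulmxDr mulmxDl. Qed.

Lemma Pi_scale_ge c Q :
  0 <= c -> psdmx Q -> loewner_le (c *: Pi Q) (Pi (c *: Q)).
Proof.
move=> c0 pQ; rewrite -(feedback_cost_optimal (psdZ c0 pQ)) feedback_costZ.
by apply: loewnerZ => //; apply: Pi_le_feedback_cost.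
Qed.

End Schur.

(** * Scalar stochastic approximation along a path *)

Section Averaging.
Context {R : realType}.
Implicit Types (a x y z l q : nat -> R) (mu c : R).

Definition step_sizes a : Prop :=
  (forall t, 0 <= a t <= 1) /\ (forall M, exists t, M <= series a t).

(** The form in which the law of large numbers is used: it is stable under linear
    combinations of [y], it determines [mu] when the sum of [a] is infinite, and
    everything proved about a single path is a deterministic consequence of it. *)
Definition compensated a y mu : Prop :=
  cvgn (series (fun t => a t * (y t - mu))).

Lemma eq_compensated a y y' mu : y =1 y' -> compensated a y mu ->
  compensated a y' mu.
Proof. by move=> /funext->. Qed.

Lemma compensatedD a y y' mu mu' : compensated a y mu ->
  compensated a y' mu' -> compensated a (fun t => y t + y' t) (mu + mu').
Proof.
move=> h h'; have := is_cvg_seriesD h h'; rewrite /compensated.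
suff -> : (fun t => a t * (y t + y' t - (mu + mu'))) =
  (fun t => a t * (y t - mu)) + (fun t => a t * (y' t - mu')) by [].
by apply/funext => t; rewrite fctE; ring.
Qed.

Lemma compensatedZ a y mu c : compensated a y mu ->
  compensated a (fun t => c * y t) (c * mu).
Proof.
move=> h; have := is_cvg_seriesZ (k := c) h; rewrite /compensated.
suff -> : (fun t => a t * (c * y t - c * mu)) =
  (c : R^o) *: ((fun t => a t * (y t - mu)) : nat -> R^o) by [].
by apply/funext => t; rewrite fctE /GRing.scale /=; ring.
Qed.

Lemma compensated0 a : compensated a (fun=> 0) 0.
Proof.
rewrite /compensated (_ : (fun t => a t * (0 - 0)) = 0 *: a).
  by rewrite seriesZ scale0r; apply: is_cvg_cst.
by apply/funext => t; rewrite fctE subrr mulr0 scale0r.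
Qed.

Lemma compensated_sum (I : Type) (r : seq I) a (y : I -> nat -> R) (mu : I -> R) :
  (forall i, compensated a (y i) (mu i)) ->
  compensated a (fun t => \sum_(i <- r) y i t) (\sum_(i <- r) mu i).
Proof.
move=> h; elim: r => [|i r IH].
  rewrite big_nil; apply: (@eq_compensated a (fun=> 0)); last first.
    exact: compensated0.
  by move=> t; rewrite big_nil.
rewrite big_cons; apply: eq_compensated (compensatedD (h i) IH) => t.
by rewrite big_cons.
Qed.

Lemma cvg_series_bounded y : cvgn (series y) ->
  exists2 K : R, 0 < K & forall t, `|series y t| <= K.
Proof.
by move=> /cvg_seq_bounded/pinfty_ex_gt0[K K0 yK]; exists K => // t; apply: yK.
Qed.

Lemma series_compensated a y mu t :
  series (fun t => a t * (y t - mu)) t =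
  series (fun t => a t * y t) t - series a t * mu.
Proof.
rewrite /series /= mulr_suml -sumrB; apply: eq_bigr => i _; ring.
Qed.

Lemma compensated_ge0 a y mu : step_sizes a -> (forall t, 0 <= y t) ->
  compensated a y mu -> 0 <= mu.
Proof.
move=> [a01 aoo] y0 /cvg_series_bounded[K K0 hK].
rewrite leNgt; apply/negP => mu0.
have [t] := aoo ((K + 1) / - mu); rewrite ler_pdivrMr ?oppr_gt0 // => h.
have := hK t; rewrite series_compensated ler_norml => /andP[_].
have : 0 <= series (fun t => a t * y t) t.
  by apply: sumr_ge0 => i _; rewrite mulr_ge0 //; have /andP[] := a01 i.
lra.
Qed.

Lemma compensated_inj a y mu mu' : step_sizes a ->
  compensated a y mu -> compensated a y mu' -> mu = mu'.
Proof.
move=> aS; wlog: mu mu' / mu <= mu' => [H h h'|le h h'].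
  by case/orP: (le_total mu mu') => le; [|apply: esym]; apply: H.
have h0 : compensated a (fun=> 0) (mu + -1 * mu').
  apply: eq_compensated (compensatedD h (compensatedZ (c := -1) h')) => t.
  by rewrite mulN1r subrr.
by have := compensated_ge0 aS (fun=> lexx 0) h0; lra.
Qed.

Lemma series_le a s t : (forall t, 0 <= a t <= 1) -> (s <= t)%N ->
  series a s <= series a t.
Proof.
move=> a01 /subnK <-; rewrite series_addn lerDl.
by apply: sumr_ge0 => i _; have /andP[] := a01 i.
Qed.

(** Once the remainder of the compensated series is subtracted from [x - mu],
    what is left contracts by [1 - a t] at each step, up to a forcing that is
    small because the remainder is. *)
Lemma averages_cvg a x y mu T : step_sizes a -> compensated a y mu ->
  (forall t, (T <= t)%N -> x t.+1 = (1 - a t) * x t + a t * y t) ->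
  forall e, 0 < e -> exists T', forall t, (T' <= t)%N -> `|x t - mu| <= e.
Proof.
move=> [a01 aoo] /cvg_ex[/= L mL] xS e3 e3_gt0.
pose e := e3 / 3; have e_gt0 : 0 < e by rewrite divr_gt0.
set m := series _ in mL.
have [T1 TT1 mLe] : exists2 T1, (T <= T1)%N &
    forall t, (T1 <= t)%N -> `|m t - L| <= e.
  have /cvgrPdist_le/(_ e e_gt0)[T1 _ h] := mL.
  exists (maxn T T1); first exact: leq_maxl.
  move=> t; rewrite geq_max => /andP[_ /h] /=; by rewrite distrC.
pose d t := x t - mu - (m t - L).
pose g t := Num.max (`|d t| - e) 0.
have gS t : (T1 <= t)%N -> g t.+1 <= (1 - a t) * g t.
  move=> T1t; have /andP[a0 a1] := a01 t.
  have dS : d t.+1 = (1 - a t) * d t - a t * (m t - L).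
    rewrite /d xS ?(leq_trans TT1) // {1}/m seriesSr /= -/m; ring.
  rewrite /g ge_max; apply/andP; split; last first.
    by rewrite mulr_ge0 ?subr_ge0 // le_max lexx orbT.
  apply: (@le_trans _ _ ((1 - a t) * (`|d t| - e))).
    have : `|d t.+1| <= (1 - a t) * `|d t| + a t * e.
      rewrite dS; apply: le_trans (ler_normB _ _) _; rewrite !normrM.
      rewrite (ger0_norm a0) ger0_norm ?subr_ge0 // lerD2l.
      by rewrite ler_wpM2l // mLe.
    lra.
  by rewrite ler_wpM2l ?subr_ge0 // le_max lexx.
(* [g t * exp (sum a)] does not increase, because [1 - a <= exp (- a)]. *)
pose C := g T1 * expR (series a T1).
have g0 t : 0 <= g t by rewrite /g le_max lexx orbT.
have gC t : (T1 <= t)%N -> g t * expR (series a t) <= C.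
  elim: t => [|t IH]; first by rewrite leqn0 => /eqP <-.
  rewrite leq_eqVlt => /orP[/eqP <- //|]; rewrite ltnS => T1t.
  apply: le_trans (IH T1t); rewrite seriesSr expRD /=.
  have h : g t.+1 * expR (a t) <= g t.
    apply: (@le_trans _ _ ((1 - a t) * g t * expR (a t))).
      by rewrite ler_wpM2r ?expR_ge0 ?gS.
    rewrite mulrAC ler_piMl // -[leRHS](expRxMexpNx_1 (a t)) mulrC.
    by rewrite ler_wpM2l ?expR_ge0 // expR_ge1Dx.
  by rewrite mulrA mulrAC [leLHS]mulrC [leRHS]mulrC ler_wpM2l ?expR_ge0 ?(mulrC _ (g t.+1)).
have C0 : 0 <= C by rewrite mulr_ge0 ?expR_ge0.
have [n hn] := aoo (C / e).
exists (maxn T1 n) => t; rewrite geq_max => /andP[T1t nt].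
have ge : g t <= e.
  rewrite -(ler_pM2r (expR_gt0 (series a t))); apply: le_trans (gC t T1t) _.
  have : C / e <= expR (series a t).
    apply: le_trans hn _; apply: le_trans (series_le a01 nt) _.
    by have := expR_ge1Dx (series a t); lra.
  by rewrite ler_pdivrMr // mulrC.
have {ge} : `|d t| <= 2 * e.
  by move: ge; rewrite /g ge_max => /andP[h _]; lra.
have := mLe t T1t; rewrite /d !ler_norml => /andP[h1 h2] /andP[h3 h4].
have -> : e3 = 3 * e by rewrite /e; field.
lra.
Qed.

(** The factors of the recursion multiply up to at most
    [exp (- c/2 sum a + O(1))], the compensated series of [l] being bounded;
    after division by this bounded factor, the compensated series of [q] is
    subtracted, which replaces [q] by the constant [qbar]. *)
Lemma contraction_bounded a z l q c lbar qbar T :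
  (forall t, 0 <= a t <= 1) -> 0 < c <= 1 ->
  (forall t, (T <= t)%N -> 0 <= z t) -> (forall t, 0 <= q t) ->
  compensated a l lbar -> compensated a q qbar -> lbar <= c / 2 ->
  (forall t, (T <= t)%N ->
     z t.+1 <= (1 - c * a t + a t * l t) * z t + a t * q t) ->
  exists M, forall t, (T <= t)%N -> z t <= M.
Proof.
move=> a01 /andP[c0 c1] z0 q0 /cvg_series_bounded[K1 K1_gt0 hK1].
move=> /cvg_series_bounded[K2 K2_gt0 hK2] lc zS.
set m := series _ in hK1; set k := series _ in hK2.
pose u t := z t * expR (- m t); pose E := expR K1.
have E_gt0 : 0 < E by exact: expR_gt0.
have mE t : expR (- m t) <= E.
  by rewrite ler_expR; have := hK1 t; rewrite ler_norml; lra.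
have mE' t : expR (m t) <= E.
  by rewrite ler_expR; have := hK1 t; rewrite ler_norml; lra.
pose c4 := c / 4; have c4_gt0 : 0 < c4 by rewrite divr_gt0.
have uS t : (T <= t)%N -> u t.+1 <= (1 - c4 * a t) * u t + E * (a t * q t).
  move=> Tt; have /andP[a0 a1] := a01 t.
  have aq0 : 0 <= a t * q t by rewrite mulr_ge0.
  have m1 : m t.+1 = m t + a t * (l t - lbar) by rewrite /m seriesSr.
  have x0 : 0 <= c / 2 * a t by rewrite mulr_ge0 // divr_ge0 // ltW.
  have x1 : c / 2 * a t <= 1 by rewrite -[leRHS]mul1r ler_pM //; lra.
  have h1 : 1 - c * a t + a t * l t <= expR (- (c / 2 * a t) + (m t.+1 - m t)).
    have := expR_ge1Dx (- (c / 2 * a t) + (m t.+1 - m t)); rewrite m1.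
    have : a t * lbar <= a t * (c / 2) by rewrite ler_wpM2l.
    lra.
  (* [exp (- x) <= 1 - x / 2] for [x] in [0, 1]. *)
  have h2 : expR (- (c / 2 * a t)) <= 1 - c4 * a t.
    have e0 := expR_gt0 (- (c / 2 * a t)).
    have e1 := expR_ge1Dx (c / 2 * a t).
    have ee := expRxMexpNx_1 (c / 2 * a t).
    move: (expR (c / 2 * a t)) (expR (- _)) e0 e1 ee => p r e0 e1 ee.
    have -> : c4 * a t = (c / 2 * a t) / 2 by rewrite /c4; field.
    move: (c / 2 * a t) x0 x1 e1 => x x0 x1 e1.
    have h : (1 + x) * r <= 1 by rewrite -[leRHS]ee ler_wpM2r // ltW.
    nra.
  rewrite /u.
  apply: (@le_trans _ _ ((expR (- (c / 2 * a t) + (m t.+1 - m t)) * z t +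
      a t * q t) * expR (- m t.+1))).
    rewrite ler_wpM2r ?expR_ge0 //; apply: le_trans (zS t Tt) _.
    by rewrite lerD2r ler_wpM2r // z0.
  rewrite mulrDl lerD //; last by rewrite mulrC ler_wpM2r.
  have -> : expR (- (c / 2 * a t) + (m t.+1 - m t)) * z t * expR (- m t.+1) =
      expR (- (c / 2 * a t)) * (z t * expR (- m t)).
    rewrite mulrAC -expRD mulrCA -expRD mulrC; congr (_ * expR _); ring.
  by rewrite ler_wpM2r // mulr_ge0 ?expR_ge0 ?z0.
pose w t := u t - E * k t.
pose D := E * K2 + E * `|qbar| / c4.
have wS t : (T <= t)%N -> w t.+1 <= (1 - c4 * a t) * w t + c4 * a t * D.
  move=> Tt; have /andP[a0 a1] := a01 t.
  have k1 : k t.+1 = k t + a t * (q t - qbar) by rewrite /k seriesSr.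
  rewrite /w k1.
  have : c4 * a t * D = c4 * a t * (E * K2) + E * (a t * `|qbar|).
    by rewrite /D; field; lra.
  have : E * (a t * qbar) <= E * (a t * `|qbar|).
    by rewrite ler_wpM2l ?(ltW E_gt0) // ler_wpM2l // ler_norm.
  have : c4 * a t * (E * - k t) <= c4 * a t * (E * K2).
    apply: ler_wpM2l; first by rewrite mulr_ge0 // ltW.
    apply: ler_wpM2l; first exact: ltW.
    by have := hK2 t; rewrite ler_norml; lra.
  have := uS t Tt; lra.
pose W := Num.max (w T) D.
have wW t : (T <= t)%N -> w t <= W.
  elim: t => [|t IH].
    by rewrite leqn0 => /eqP <-; rewrite /W le_max lexx.
  rewrite leq_eqVlt => /orP[/eqP <-|]; first by rewrite /W le_max lexx.
  rewrite ltnS => Tt; apply: le_trans (wS t Tt) _.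
  have /andP[a0 a1] := a01 t.
  have b0 : 0 <= c4 * a t by rewrite mulr_ge0 // ltW.
  have b1 : c4 * a t <= 1 by rewrite /c4; nra.
  have -> : W = (1 - c4 * a t) * W + c4 * a t * W by ring.
  rewrite lerD // ler_wpM2l ?subr_ge0 // ?IH //.
  by rewrite /W le_max lexx orbT.
exists ((`|W| + E * K2) * E) => t Tt.
have -> : z t = u t * expR (m t).
  by rewrite /u -mulrA (mulrC (expR (- _))) expRxMexpNx_1 mulr1.
have u0 : 0 <= u t by rewrite mulr_ge0 ?expR_ge0 ?z0.
rewrite ler_pM ?expR_ge0 //.
have := wW t Tt; have := ler_norm W.
have : E * k t <= E * K2.
  rewrite ler_wpM2l ?(ltW E_gt0) //.
  by have := hK2 t; rewrite ler_norml; lra.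
rewrite /w; lra.
Qed.

End Averaging.

(** * Compensated matrix sequences and the mean operator *)

Section Tools.
Context {R : realType}.

Lemma eventually_all (I : finType) (F : I -> nat -> Prop) :
  (forall i, exists T, forall t, (T <= t)%N -> F i t) ->
  exists T, forall t, (T <= t)%N -> forall i, F i t.
Proof.
move=> /choice[f hf]; exists (\max_i f i)%N => t ht i.
by apply: hf; apply: leq_trans ht; apply: leq_bigmax.
Qed.

Lemma bounded_from (f : nat -> R) T M :
  (forall t, (T <= t)%N -> f t <= M) -> exists M', forall t, f t <= M'.
Proof.
elim: T => [|T IH] in M * => fM; first by exists M => t; apply: fM.
apply: (IH (Num.max (f T) M)) => t; rewrite leq_eqVlt => /orP[/eqP <-|/fM h].
  by rewrite le_max lexx.
by rewrite le_max h orbT.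
Qed.

Lemma linear_form_expand p q (f : 'M[R]_(p, q) -> R) X :
  (forall c X Y, f (c *: X + Y) = c * f X + f Y) ->
  f X = \sum_i \sum_j X i j * f (delta_mx i j).
Proof.
move=> fL; have f0 : f 0 = 0.
  by have := fL (-1) 0 0; rewrite scaler0 addr0 mulN1r addNr.
have fD X' Y : f (X' + Y) = f X' + f Y by have := fL 1 X' Y; rewrite scale1r mul1r.
have fZ c X' : f (c *: X') = c * f X' by have := fL c X' 0; rewrite f0 !addr0.
rewrite [X in f X = _]matrix_sum_delta (big_morph f fD f0).
by apply: eq_bigr => i _; rewrite (big_morph f fD f0); apply: eq_bigr => j _.
Qed.

Lemma sum_psd_entries_le d (X w : 'M[R]_d) : psdmx X ->
  `|\sum_i \sum_j X i j * w i j| <= (\sum_i \sum_j `|w i j|) * \tr X.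
Proof.
move=> pX; rewrite mulr_suml; apply: le_trans (ler_norm_sum _ _ _) _.
apply: ler_sum => i _; rewrite mulr_suml; apply: le_trans (ler_norm_sum _ _ _) _.
apply: ler_sum => j _; rewrite normrM mulrC ler_wpM2l //.
exact: psd_entry_le_tr.
Qed.

End Tools.

Section MeanOperator.
Context {R : realType} {n d : nat}.
Variables (a : nat -> R) (L : nat -> 'M[R]_(n, d)).
Variable T : 'I_n -> 'I_n -> 'M[R]_d.
Hypothesis aS : step_sizes a.

Definition mx_compensated p q (Y : nat -> 'M[R]_(p, q)) (M : 'M[R]_(p, q)) : Prop :=
  forall i j, compensated a (fun t => Y t i j) (M i j).

Hypothesis LT : forall p q, mx_compensated (fun t => (row p (L t))^T *m row q (L t)) (T p q).

(** [G |-> E (L^T G L)] when [T p q] is the mean of [(row p L)^T (row q L)]. *)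
Definition mean_op (G : 'M[R]_n) : 'M[R]_d :=
  \sum_p \sum_q G p q *: T p q.

Lemma mean_op_linear c G G' : mean_op (c *: G + G') = c *: mean_op G + mean_op G'.
Proof.
rewrite /mean_op scaler_sumr -big_split; apply: eq_bigr => p _.
rewrite scaler_sumr -big_split; apply: eq_bigr => q _.
by rewrite !mxE scalerDl scalerA.
Qed.

Lemma mean_opZ c G : mean_op (c *: G) = c *: mean_op G.
Proof.
rewrite /mean_op scaler_sumr; apply: eq_bigr => p _.
rewrite scaler_sumr; apply: eq_bigr => q _.
by rewrite !mxE scalerA.
Qed.

Lemma mean_opB G G' : mean_op (G - G') = mean_op G - mean_op G'.
Proof. by rewrite addrC -scaleN1r mean_op_linear scaleN1r addrC. Qed.

Lemma mx_compensated_congr G :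
  mx_compensated (fun t => (L t)^T *m G *m L t) (mean_op G).
Proof.
move=> i j.
pose y p q t := G p q * ((row p (L t))^T *m row q (L t)) i j.
rewrite /mean_op summxE; under [X in compensated _ _ X]eq_bigr do rewrite summxE.
apply: (@eq_compensated _ _ (fun t => \sum_p \sum_q y p q t)).
  move=> t; rewrite mxE exchange_big /=; apply: eq_bigr => q _.
  rewrite mxE mulr_suml; apply: eq_bigr => p _.
  by rewrite /y !mxE big_ord1 !mxE; ring.
apply: compensated_sum => p; apply: compensated_sum => q.
by rewrite mxE; apply: compensatedZ; apply: LT.
Qed.

Lemma mx_compensatedD p q (Y Y' : nat -> 'M[R]_(p, q)) M M' :
  mx_compensated Y M -> mx_compensated Y' M' ->
  mx_compensated (fun t => Y t + Y' t) (M + M').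
Proof.
move=> h h' i j; rewrite mxE; apply: eq_compensated (compensatedD (h i j) (h' i j)).
by move=> t; rewrite mxE.
Qed.

Lemma compensated_form p q (f : 'M[R]_(p, q) -> R) (Y : nat -> 'M[R]_(p, q)) M :
  (forall c X Y, f (c *: X + Y) = c * f X + f Y) ->
  mx_compensated Y M -> compensated a (fun t => f (Y t)) (f M).
Proof.
move=> fL YM; rewrite (linear_form_expand M fL).
apply: (@eq_compensated _ _
  (fun t => \sum_i \sum_j f (delta_mx i j) * Y t i j)).
  move=> t; rewrite (linear_form_expand (Y t) fL); apply: eq_bigr => i _.
  by apply: eq_bigr => j _; rewrite mulrC.
apply: compensated_sum => i; apply: compensated_sum => j.
by rewrite mulrC; apply: compensatedZ.
Qed.

Lemma psd_compensated (Y : nat -> 'M[R]_d) M :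
  (forall t, psdmx (Y t)) -> mx_compensated Y M -> psdmx M.
Proof.
move=> pY YM; split=> [|x].
  apply/matrixP => i j; rewrite mxE; apply: compensated_inj aS _ (YM i j).
  apply: eq_compensated (YM j i) => t.
  by rewrite -{2}(psd_sym (pY t)) mxE.
apply: (compensated_ge0 (y := fun t => qform (Y t) x) aS).
  by move=> t; apply: psd_qform.
apply: (compensated_form (f := fun M => qform M x) _ YM) => c X X'.
by rewrite qformD qformZ.
Qed.

Lemma psd_mean_op G : psdmx G -> psdmx (mean_op G).
Proof.
move=> pG; apply: (@psd_compensated (fun t => (L t)^T *m G *m L t)) => [t|].
  exact: psd_congr.
exact: mx_compensated_congr.
Qed.

Lemma loewner_mean_op G G' : loewner_le G G' ->
  loewner_le (mean_op G) (mean_op G').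
Proof. by rewrite /loewner_le -mean_opB; apply: psd_mean_op. Qed.

(** The averages of [Y], started at [X T0], stay below [X] and converge entrywise
    to [M]; a symmetric matrix with small entries is below [l *: 1%:M]. *)
Lemma averages_lower (X Y : nat -> 'M[R]_d) M M' l T0 :
  mx_compensated Y M -> (forall t, psdmx (Y t)) -> psdmx (X T0) ->
  (forall t, (T0 <= t)%N ->
    loewner_le ((1 - a t) *: X t + a t *: Y t) (X t.+1)) ->
  0 < l -> loewner_le (M' + l *: 1%:M) M ->
  exists T1, forall t, (T1 <= t)%N -> loewner_le M' (X t).
Proof.
move=> YM pY pX XS l0 gap.
pose y := fix y k := if k is k'.+1 then
  (1 - a (T0 + k')%N) *: y k' + a (T0 + k')%N *: Y (T0 + k')%N else X T0.
have a01 t : 0 <= a t /\ 0 <= 1 - a t.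
  by have /andP[? ?] := aS.1 t; rewrite subr_ge0.
have py k : psdmx (y k).
  by elim: k => //= k IH; have [? ?] := a01 (T0 + k)%N; apply: psdD; apply: psdZ.
have yX k : loewner_le (y k) (X (T0 + k)%N).
  elim: k => [|k IH]; first by rewrite addn0; apply: loewner_refl.
  have [? ?] := a01 (T0 + k)%N.
  rewrite addnS; apply: loewner_trans (XS _ (leq_addr _ _)) => /=.
  by apply: loewnerD; [apply: loewnerZ|apply: loewner_refl].
pose e := l / d.+1%:R.
have e0 : 0 < e by rewrite divr_gt0 ?ltr0n.
have [T1 hT1] : exists T1, forall t, (T1 <= t)%N ->
    forall ij : 'I_d * 'I_d, `|y (t - T0)%N ij.1 ij.2 - M ij.1 ij.2| <= e.
  apply: eventually_all => -[i j] /=.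
  apply: (averages_cvg (x := fun t => y (t - T0)%N i j) (T := T0) aS (YM i j)) => // t T0t.
  by rewrite subSn //= subnKC // !mxE.
exists (maxn T0 T1) => t; rewrite geq_max => /andP[T0t T1t].
apply: (@loewner_trans _ _ (y (t - T0)%N)); last by have := yX (t - T0)%N; rewrite subnKC.
have sM : M^T = M by exact/psd_sym/(psd_compensated pY YM).
have : loewner_le (M - y (t - T0)%N) ((d%:R * e) *: 1%:M).
  apply: loewner_entries => [|i j]; first by rewrite linearB /= sM (psd_sym (py _)).
  by rewrite !mxE distrC; apply: (hT1 t T1t (i, j)).
have de : loewner_le ((d%:R * e) *: 1%:M : 'M[R]_d) (l *: 1%:M).
  rewrite /loewner_le -scalerBl; apply: psdZ; last exact: psd1.
  rewrite subr_ge0 /e mulrCA ger_pMr // ler_pdivrMr ?ltr0n // mul1r.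
  by rewrite ler_nat.
move=> /loewner_trans /(_ de) h.
have := psdD h gap; rewrite /loewner_le.
suff -> : l *: 1%:M - (M - y (t - T0)%N) + (M - (M' + l *: 1%:M)) =
  y (t - T0)%N - M' by [].
move: (l *: 1%:M) (y _) => A B; apply/matrixP => i j; rewrite !mxE; ring.
Qed.

End MeanOperator.

(** * Boundedness of the linear recursion of a fixed gain *)

Lemma step_psd {R : realType} d c (Q M : 'M[R]_d) :
  0 <= c <= 1 -> psdmx Q -> psdmx M -> psdmx (Q + c *: (M - Q)).
Proof.
move=> /andP[? ?] pQ pM.
have -> : Q + c *: (M - Q) = (1 - c) *: Q + c *: M.
  by apply/matrixP => i j; rewrite !mxE; ring.
by apply: psdD; apply: psdZ; rewrite ?subr_ge0.
Qed.

Section LinearRecursion.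
Context {R : realType} {n m : nat}.
Notation d := (n + m)%N.
Variables (a : nat -> R) (L : nat -> 'M[R]_(n, d)) (N : nat -> 'M[R]_d).
Variables (H : 'M[R]_d) (T : 'I_n -> 'I_n -> 'M[R]_d).
Hypothesis aS : step_sizes a.
Hypothesis pN : forall t, psdmx (N t).
Hypothesis NH : mx_compensated a N H.
Hypothesis LT : forall p q,
  mx_compensated a (fun t => (row p (L t))^T *m row q (L t)) (T p q).

Section FixedGain.
Variables (K : 'M[R]_(m, n)).

Definition closed_loop t (X : 'M[R]_d) : 'M[R]_d :=
  (L t)^T *m feedback_cost K X *m L t.

Definition mean_closed_loop (X : 'M[R]_d) : 'M[R]_d :=
  mean_op T (feedback_cost K X).

Lemma psd_closed_loop t X : psdmx X -> psdmx (closed_loop t X).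
Proof. by move=> pX; apply/psd_congr/psd_feedback_cost. Qed.

Lemma psd_mean_closed_loop X : psdmx X -> psdmx (mean_closed_loop X).
Proof. by move=> pX; apply/(psd_mean_op aS LT)/psd_feedback_cost. Qed.

Lemma closed_loop_compensated X :
  mx_compensated a (fun t => closed_loop t X) (mean_closed_loop X).
Proof. exact: mx_compensated_congr. Qed.

Lemma closed_loop_linear t c X Y :
  closed_loop t (c *: X + Y) = c *: closed_loop t X + closed_loop t Y.
Proof.
rewrite /closed_loop feedback_costD feedback_costZ.
by rewrite mulmxDr mulmxDl -scalemxAr -scalemxAl.
Qed.

Lemma mean_closed_loop_linear c X Y :
  mean_closed_loop (c *: X + Y) = c *: mean_closed_loop X + mean_closed_loop Y.
Proof. by rewrite /mean_closed_loop feedback_costD feedback_costZ mean_op_linear. Qed.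

Lemma mean_closed_loopZ c X : mean_closed_loop (c *: X) = c *: mean_closed_loop X.
Proof. by rewrite /mean_closed_loop feedback_costZ mean_opZ. Qed.

Lemma loewner_closed_loop t X Y : loewner_le X Y ->
  loewner_le (closed_loop t X) (closed_loop t Y).
Proof. by move=> XY; apply/loewner_congr/loewner_feedback_cost. Qed.

Lemma loewner_mean_closed_loop X Y : loewner_le X Y ->
  loewner_le (mean_closed_loop X) (mean_closed_loop Y).
Proof. by move=> XY; apply/(loewner_mean_op aS LT)/loewner_feedback_cost. Qed.

Variables (P : 'M[R]_d) (l : R).
Hypothesis l0 : 0 < l.
Hypothesis pP : psdmx P.
Hypothesis superP : loewner_le (l *: 1%:M + mean_closed_loop P) P.

(** [P] is a supersolution with a definite margin, so the mean closed loop
    contracts in the order-unit norm of [P]. *)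
Lemma mean_closed_loop_power : exists2 C, 0 <= C & exists2 r, 0 < r < 1 &
  forall k X, psdmx X -> \tr (iter k mean_closed_loop X) <= C * r ^+ k * \tr X.
Proof.
have lP : loewner_le (l *: 1%:M) P.
  apply: loewner_trans superP; rewrite -{1}[l *: _]addr0.
  apply: loewnerD; first exact: loewner_refl.
  exact/loewner0/psd_mean_closed_loop.
pose mu := d%:R * \tr P + l.
have mu0 : 0 < mu by rewrite ltr_wpDl // mulr_ge0 ?ler0n ?psd_tr_ge0.
have Pmu : loewner_le P (mu *: 1%:M).
  rewrite /mu scalerDl -[P in loewner_le P _]addr0; apply: loewnerD; first exact: psd_le_tr.
  by apply/loewner0; apply: psdZ; [exact: ltW|exact: psd1].
pose r := 1 - l / (2 * mu).
have e0 : 0 < l / (2 * mu) by rewrite divr_gt0 ?mulr_gt0.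
have e1 : l / (2 * mu) < 1.
  rewrite ltr_pdivrMr ?mulr_gt0 // mul1r /mu.
  have : 0 <= d%:R * \tr P by rewrite mulr_ge0 ?ler0n ?psd_tr_ge0.
  by have := l0; move: (d%:R * \tr P) => x; lra.
have AP : loewner_le (mean_closed_loop P) (r *: P).
  have h : loewner_le ((l / (2 * mu)) *: P) (l *: 1%:M).
    apply: loewner_trans (loewnerZ (ltW e0) Pmu) _; rewrite scalerA.
    have -> : l / (2 * mu) * mu = l / 2 by field; rewrite gt_eqF.
    rewrite /loewner_le -scalerBl; apply: psdZ; last exact: psd1.
    by have := l0; lra.
  have := loewnerD h superP; rewrite /loewner_le /r.
  move: (mean_closed_loop P) (l *: _) => A I; set e := l / _.
  suff -> : I + P - (e *: P + (I + A)) = (1 - e) *: P - A by [].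
  by apply/matrixP => i j; rewrite !mxE; ring.
have iterP k : loewner_le (iter k mean_closed_loop P) (r ^+ k *: P).
  elim: k => [|k IH]; first by rewrite expr0 scale1r; apply: loewner_refl.
  rewrite iterS exprS mulrC -scalerA.
  apply: loewner_trans (loewner_mean_closed_loop IH) _.
  rewrite mean_closed_loopZ; apply: loewnerZ => //.
  by rewrite exprn_ge0 // subr_ge0 ltW.
have iterZ k c X : iter k mean_closed_loop (c *: X) = c *: iter k mean_closed_loop X.
  by elim: k => //= k ->; rewrite mean_closed_loopZ.
have iterL k X Y : loewner_le X Y ->
    loewner_le (iter k mean_closed_loop X) (iter k mean_closed_loop Y).
  by move=> XY; elim: k => //= k; apply: loewner_mean_closed_loop.
exists (d%:R / l * \tr P).
  by rewrite mulr_ge0 ?psd_tr_ge0 // divr_ge0 // ltW.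
exists r; first by rewrite /r; lra.
move=> k X pX.
have XP : loewner_le X ((d%:R * \tr X / l) *: P).
  apply: loewner_trans (psd_le_tr pX) _.
  have E : d%:R * \tr X = d%:R * \tr X / l * l by field; rewrite gt_eqF.
  rewrite [Y in loewner_le (Y *: _) _]E -scalerA; apply: loewnerZ => //.
  by rewrite divr_ge0 ?mulr_ge0 ?psd_tr_ge0 // ltW.
have := loewner_tr (iterL k _ _ XP); rewrite iterZ linearZ /= => /le_trans; apply.
have c0 : 0 <= d%:R * \tr X / l by rewrite divr_ge0 ?mulr_ge0 ?psd_tr_ge0 // ltW.
apply: le_trans (ler_wpM2l c0 (loewner_tr (iterP k))) _.
rewrite linearZ /= le_eqVlt; apply/orP; left; apply/eqP.
by field; rewrite gt_eqF.
Qed.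

(** The Lyapunov functional [V X = sum_(k <= K) tr (A^k X)] of the mean closed
    loop [A]: the decrement telescopes to [tr X - tr (A^(K+1) X)]. *)
Lemma lyapunov_functional : exists V : 'M[R]_d -> R,
  [/\ forall c X Y, V (c *: X + Y) = c * V X + V Y,
      forall X, psdmx X -> \tr X <= V X &
      forall X, psdmx X -> V (mean_closed_loop X) <= V X - \tr X / 2].
Proof.
have [C C0 [r /andP[r0 r1] hr]] := mean_closed_loop_power.
have [k hk] : exists k, C * r ^+ k.+1 <= 2^-1.
  have /cvg_expr/cvgrPdist_le : `|r| < 1 by rewrite gtr0_norm.
  have e0 : 0 < (2 * (C + 1))^-1 by rewrite invr_gt0; lra.
  move=> /(_ _ e0)[k _ /(_ k (leqnn k))] /=.
  rewrite sub0r normrN ger0_norm ?exprn_ge0 ?(ltW r0) // => h; exists k.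
  have rk : 0 <= r ^+ k by rewrite exprn_ge0 // ltW.
  rewrite exprS; apply: (@le_trans _ _ ((C + 1) * (2 * (C + 1))^-1)).
    rewrite ler_pM ?mulr_ge0 ?(ltW r0) //; first by rewrite lerDl.
    by apply: le_trans h; rewrite ler_piMl // ltW.
  by rewrite invfM mulrCA divff ?mulr1 //; lra.
have iterM j c X Y : iter j mean_closed_loop (c *: X + Y) =
    c *: iter j mean_closed_loop X + iter j mean_closed_loop Y.
  by elim: j => //= j ->; rewrite mean_closed_loop_linear.
have pI j X : psdmx X -> psdmx (iter j mean_closed_loop X).
  by move=> pX; elim: j => //= j; apply: psd_mean_closed_loop.
exists (fun X => \sum_(j < k.+1) \tr (iter j mean_closed_loop X)); split.
- move=> c X Y; rewrite mulr_sumr -big_split; apply: eq_bigr => j _.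
  by rewrite iterM linearD linearZ.
- move=> X pX; rewrite big_ord_recl /= lerDl; apply: sumr_ge0 => j _.
  by apply: psd_tr_ge0; apply: (pI j.+1).
- move=> X pX.
  under eq_bigr do rewrite -iterSr.
  rewrite big_ord_recr [in leRHS]big_ord_recl /=.
  have := hr k.+1 X pX; have := ler_wpM2r (psd_tr_ge0 pX) hk.
  rewrite /=; move: (\sum_(j < k) _) => S; lra.
Qed.

(** [V (X t)] is corrected by the tail [rho t] of the convergent series of the
    fluctuations of [V (closed_loop t _)].  In the scalar recursion of the
    corrected sequence the noise of the linear map is multiplied by the small
    [rho], and [contraction_bounded] applies. *)
Lemma linear_recursion_bounded (X : nat -> 'M[R]_d) :
  psdmx (X 0%N) ->
  (forall t, X t.+1 = X t + a t *: (N t + closed_loop t (X t) - X t)) ->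
  exists M, forall t, \tr (X t) <= M.
Proof.
move=> pX0 XS; have [V [VL Vtr VA]] := lyapunov_functional.
have pX t : psdmx (X t).
  elim: t => // t IH; rewrite XS; apply: (step_psd (aS.1 t)) => //.
  by apply: psdD => //; apply: psd_closed_loop.
have V0 : V 0 = 0 by have := VL (-1) 0 0; rewrite scaler0 addr0 mulN1r addNr.
have VD A B : V (A + B) = V A + V B by have := VL 1 A B; rewrite scale1r mul1r.
pose A0 := mean_closed_loop.
pose Cv := \sum_i \sum_j `|V (delta_mx i j)|.
have Cv0 : 0 <= Cv by apply: sumr_ge0 => i _; apply: sumr_ge0.
have VC Y : psdmx Y -> V Y <= Cv * \tr Y.
  move=> pY; rewrite (linear_form_expand Y VL); apply: le_trans (ler_norm _) _.
  have := sum_psd_entries_le (\matrix_(i, j) V (delta_mx i j)) pY.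
  rewrite /Cv; under eq_bigr do under eq_bigr do rewrite mxE.
  move=> /le_trans; apply; rewrite ler_wpM2r ?psd_tr_ge0 //.
  by apply: ler_sum => i _; apply: ler_sum => j _; rewrite mxE.
pose D t i j := V (closed_loop t (delta_mx i j)) - V (A0 (delta_mx i j)).
have Dcvg i j : cvgn (series (fun t => a t * D t i j)).
  exact: (compensated_form VL (closed_loop_compensated (X := delta_mx i j))).
pose rm t : 'M[R]_d := \matrix_(i, j)
  (limn (series (fun t => a t * D t i j)) - series (fun t => a t * D t i j) t).
pose rho t (Y : 'M[R]_d) := \sum_i \sum_j Y i j * rm t i j.
have rhoL t c Y Z : rho t (c *: Y + Z) = c * rho t Y + rho t Z.
  rewrite /rho mulr_sumr -big_split /=; apply: eq_bigr => i _.
  rewrite mulr_sumr -big_split /=; apply: eq_bigr => j _.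
  by move: (rm t i j) => e; rewrite !mxE; ring.
have VDt t Y : V (closed_loop t Y) - V (A0 Y) = \sum_i \sum_j Y i j * D t i j.
  rewrite (linear_form_expand (f := fun Y => V (closed_loop t Y) - V (A0 Y))) //.
  move=> c Y1 Y2; rewrite closed_loop_linear /A0 mean_closed_loop_linear !VL; ring.
have rhoS t Y : rho t.+1 Y = rho t Y - a t * (V (closed_loop t Y) - V (A0 Y)).
  rewrite VDt /rho mulr_sumr -sumrB; apply: eq_bigr => i _.
  rewrite mulr_sumr -sumrB; apply: eq_bigr => j _.
  by rewrite !mxE seriesSr /=; ring.
pose lbar := d%:R * \tr (A0 1%:M).
have lbar0 : 0 <= lbar.
  rewrite mulr_ge0 // psd_tr_ge0 //; apply: psd_mean_closed_loop; exact: psd1.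
(* Per unit of step size, [z] decreases by at least [c z] before the noise of the
   linear map, and [dl] makes this noise cost at most half of that on average. *)
pose c := (4 * (Cv + 1))^-1.
have c0 : 0 < c by rewrite invr_gt0; lra.
have c1 : c <= 1 by rewrite invf_le1; lra.
pose dl := Num.min (4^-1) (c / (4 * (lbar + 1))).
have dl0 : 0 < dl by rewrite lt_min invr_gt0 ltr0n divr_gt0 //; lra.
have dl4 : dl <= 4^-1 by rewrite ge_min lexx.
have dlc : 2 * dl * lbar <= c / 2.
  have : dl <= c / (4 * (lbar + 1)) by rewrite ge_min lexx orbT.
  rewrite ler_pdivlMr; last lra.
  by have := dl0; lra.
have [T0 hT0] : exists T0, forall t, (T0 <= t)%N ->
    forall Y, psdmx Y -> `|rho t Y| <= dl * \tr Y.
  pose e := dl / (d ^ 2).+1%:R.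
  have e0 : 0 < e by rewrite divr_gt0 ?ltr0n.
  have [T0 h] : exists T0, forall t, (T0 <= t)%N ->
      forall ij : 'I_d * 'I_d, `|rm t ij.1 ij.2| <= e.
    apply: eventually_all => -[i j] /=.
    have /cvgrPdist_le/(_ e e0)[T0 _ h] := Dcvg i j.
    by exists T0 => t /h /=; rewrite mxE.
  exists T0 => t T0t Y pY; apply: le_trans (sum_psd_entries_le _ pY) _.
  rewrite ler_wpM2r ?psd_tr_ge0 //.
  apply: (@le_trans _ _ (\sum_(i < d) \sum_(j < d) e)).
    by apply: ler_sum => i _; apply: ler_sum => j _; apply: (h t T0t (i, j)).
  rewrite !sumr_const !card_ord -mulrnA -mulr_natr mulnn /e -mulrA.
  rewrite ler_piMr ?(ltW dl0) // ler_pdivrMl ?ltr0n // mulr1.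
  by rewrite ler_nat.
pose z t := V (X t) + rho t (X t).
have trX t := psd_tr_ge0 (pX t).
have zlb t : (T0 <= t)%N -> \tr (X t) / 2 <= z t.
  move=> T0t; have := hT0 t T0t _ (pX t); rewrite ler_norml => /andP[h _].
  have := Vtr _ (pX t); have := trX t; rewrite /z.
  have := ler_wpM2r (trX t) dl4; lra.
have zub t : (T0 <= t)%N -> z t <= (Cv + 1) * \tr (X t).
  move=> T0t; have := hT0 t T0t _ (pX t); rewrite ler_norml => /andP[_ h].
  have := VC _ (pX t); have := trX t; rewrite /z.
  have := ler_wpM2r (trX t) dl4; lra.
pose ell t := d%:R * \tr (closed_loop t 1%:M).
have ellP t : \tr (closed_loop t (X t)) <= ell t * \tr (X t).
  have := loewner_tr (loewner_closed_loop t (psd_le_tr (pX t))).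
  have -> : closed_loop t ((d%:R * \tr (X t)) *: 1%:M) =
      (d%:R * \tr (X t)) *: closed_loop t 1%:M.
    by rewrite /closed_loop feedback_costZ -scalemxAr -scalemxAl.
  by rewrite linearZ /= /ell mulrAC.
have ell0 t : 0 <= ell t.
  rewrite mulr_ge0 // psd_tr_ge0 //; apply: psd_closed_loop; exact: psd1.
have trL c' (Y Z : 'M[R]_d) : \tr (c' *: Y + Z) = c' * \tr Y + \tr Z.
  by rewrite linearD linearZ.
have ell_comp : compensated a (fun t => 2 * dl * ell t) (2 * dl * lbar).
  apply: compensatedZ; apply: compensatedZ; exact: (compensated_form trL (closed_loop_compensated (X := 1%:M))).
have q_comp : compensated a (fun t => (Cv + 1) * \tr (N t)) ((Cv + 1) * \tr H).
  by apply: compensatedZ; exact: (compensated_form trL NH).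
have trN t := psd_tr_ge0 (pN t).
have [M hM] : exists M, forall t, (T0 <= t)%N -> z t <= M.
  apply: (contraction_bounded (c := c) aS.1 _ _ _ ell_comp q_comp dlc).
  - by rewrite c0.
  - by move=> t /zlb; apply: le_trans; rewrite divr_ge0.
  - by move=> t; rewrite mulr_ge0 //; lra.
  move=> t T0t; have /andP[a0 _] := aS.1 t.
  have -> : z t.+1 = z t + a t * (V (N t) + V (A0 (X t)) - V (X t))
      + a t * (rho t.+1 (N t) + rho t.+1 (closed_loop t (X t)) - rho t.+1 (X t)).
    have VZ c' Y : V (c' *: Y) = c' * V Y by have := VL c' Y 0; rewrite V0 !addr0.
    have r0 : rho t.+1 0 = 0.
      by have := rhoL t.+1 (-1) 0 0; rewrite scaler0 addr0 mulN1r addNr.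
    have rD Y Z : rho t.+1 (Y + Z) = rho t.+1 Y + rho t.+1 Z.
      by have := rhoL t.+1 1 Y Z; rewrite scale1r mul1r.
    have rZ c' Y : rho t.+1 (c' *: Y) = c' * rho t.+1 Y.
      by have := rhoL t.+1 c' Y 0; rewrite r0 !addr0.
    rewrite /z XS -scaleN1r !(VD, VZ, rD, rZ) (rhoS t (X t)); ring.
  have T0t' : (T0 <= t.+1)%N by apply: leqW.
  have pC := psd_closed_loop t (pX t).
  have := hT0 _ T0t' _ (pN t); have := hT0 _ T0t' _ pC.
  have := hT0 _ T0t' _ (pX t); rewrite !ler_norml.
  move=> /andP[x1 _] /andP[_ x2] /andP[_ x3].
  have x4 := VC _ (pN t); have x5 := VA _ (pX t).
  have x6 := ler_wpM2l (ltW dl0) (ellP t).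
  have x7 := ler_wpM2r (trN t) dl4; have x8 := ler_wpM2r (trX t) dl4.
  have x9 : c * z t <= \tr (X t) / 4.
    have := ler_wpM2l (ltW c0) (zub t T0t).
    suff -> : c * ((Cv + 1) * \tr (X t)) = \tr (X t) / 4 by [].
    by rewrite /c; field; lra.
  have x10 : 2 * dl * ell t * z t >= dl * (ell t * \tr (X t)).
    have := ler_wpM2l (mulr_ge0 (ltW dl0) (ell0 t)) (zlb t T0t); lra.
  have x11 := trN t.
  have : a t * (V (N t) + V (A0 (X t)) - V (X t)) + a t * (rho t.+1 (N t) +
      rho t.+1 (closed_loop t (X t)) - rho t.+1 (X t)) <=
      a t * (- (c * z t) + 2 * dl * ell t * z t + (Cv + 1) * \tr (N t)).
    rewrite -mulrDr ler_wpM2l //.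
    by move: x1 x2 x3 x4 x5 x6 x7 x8 x9 x10 x11; rewrite /A0; lra.
  lra.
apply: (bounded_from (T := T0) (M := 2 * M)) => t T0t.
have := zlb t T0t; have := hM t T0t; lra.
Qed.

End FixedGain.
End LinearRecursion.

(** * Supersolutions and bounded paths *)

Lemma qlearning_psd {R : realType} {n m : nat} (a : nat -> R)
    (L : nat -> 'M[R]_(n, n + m)) (N : nat -> 'M[R]_(n + m)) (Q : nat -> 'M[R]_(n + m)) t :
  (forall t, 0 <= a t <= 1) -> (forall t, psdmx (N t)) -> psdmx (Q 0%N) ->
  (forall t, Q t.+1 = Q t + a t *: (N t + (L t)^T *m Pi (Q t) *m L t - Q t)) ->
  psdmx (Q t).
Proof.
move=> a01 pN pQ0 QS; elim: t => // t IH; rewrite QS; apply: (step_psd (a01 t)) => //.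
by apply: psdD => //; apply/psd_congr/psd_Pi.
Qed.

Section Dichotomy.
Context {R : realType} {n m : nat}.
Notation d := (n + m)%N.
Variables (a : nat -> R) (L : nat -> 'M[R]_(n, d)) (N : nat -> 'M[R]_d).
Variables (H : 'M[R]_d) (T : 'I_n -> 'I_n -> 'M[R]_d).
Hypothesis aS : step_sizes a.
Hypothesis pN : forall t, psdmx (N t).
Hypothesis NH : mx_compensated a N H.
Hypothesis LT : forall p q,
  mx_compensated a (fun t => (row p (L t))^T *m row q (L t)) (T p q).
Hypothesis pdH : pdmx H.

Variable Q : nat -> 'M[R]_d.
Hypothesis pQ0 : psdmx (Q 0%N).
Hypothesis QS : forall t,
  Q t.+1 = Q t + a t *: (N t + (L t)^T *m Pi (Q t) *m L t - Q t).

Let psd_Q t : psdmx (Q t).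
Proof. exact: qlearning_psd aS.1 pN pQ0 QS. Qed.

Definition supersolution (P : 'M[R]_d) : Prop :=
  psdmx P /\ loewner_le (2^-1 *: H + mean_op T (Pi P)) P.

(** With the gain that is optimal for the supersolution, the linear recursion
    dominates [Q] and its mean map decreases the supersolution. *)
Lemma supersolution_bounded P : supersolution P ->
  exists M, forall t, \tr (Q t) <= M.
Proof.
move=> [pP superP]; pose K := optimal_gain P.
have [l l0 lH] := pd_lower_bound pdH.
pose X := fix X t := if t is t'.+1 then
  X t' + a t' *: (N t' + closed_loop L K t' (X t') - X t') else Q 0%N.
have QX t : loewner_le (Q t) (X t).
  elim: t => [|t IH]; first exact: loewner_refl.
  rewrite QS /=; have /andP[a0 a1] := aS.1 t.
  have E (A B : 'M[R]_d) : A + a t *: (B - A) = (1 - a t) *: A + a t *: B.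
    by apply/matrixP => i j; rewrite !mxE; ring.
  rewrite !E; apply: loewnerD; apply: loewnerZ; rewrite ?subr_ge0 //.
  apply: loewnerD; first exact: loewner_refl.
  apply: loewner_congr; apply: loewner_trans (Pi_le_feedback_cost K (psd_Q t)) _.
  exact: loewner_feedback_cost.
have l20 : 0 < l / 2 by rewrite divr_gt0.
have super' : loewner_le ((l / 2) *: 1%:M + mean_closed_loop T K P) P.
  apply: loewner_trans superP; rewrite /mean_closed_loop feedback_cost_optimal //.
  apply: loewnerD; last exact: loewner_refl.
  by rewrite [l / 2]mulrC -scalerA; apply: loewnerZ; rewrite // invr_ge0.
have [M hM] := linear_recursion_bounded aS pN NH LT l20 pP super' (X := X) pQ0
  (fun t => erefl).
by exists M => t; apply: le_trans (loewner_tr (QX t)) (hM t).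
Qed.

Definition value_iteration k : 'M[R]_d :=
  iter k (fun P => H + mean_op T (Pi P)) 0.

Lemma psd_value_iteration k : psdmx (value_iteration k).
Proof.
elim: k => [|k IH]; first exact: psd0.
apply: psdD; first exact: pd_psd.
exact/(psd_mean_op aS LT)/psd_Pi.
Qed.

Lemma value_iteration_le k :
  loewner_le (value_iteration k) (value_iteration k.+1).
Proof.
elim: k => [|k IH]; first exact/loewner0/(psd_value_iteration 1).
apply: loewnerD; first exact: loewner_refl.
apply: (loewner_mean_op aS LT); apply: loewner_Pi IH.
exact: psd_value_iteration.
Qed.

(** Once [Q] exceeds [s] times an iterate, it exceeds averages whose mean is at
    least [s] times the next iterate, with the margin [(1 - s) H]. *)
Lemma value_iteration_liminf k s : 0 <= s < 1 ->
  exists T0, forall t, (T0 <= t)%N -> loewner_le (s *: value_iteration k) (Q t).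
Proof.
move=> /andP[s0 s1]; elim: k => [|k [T0 IH]].
  by exists 0%N => t _; rewrite /value_iteration /= scaler0; apply/loewner0/psd_Q.
have [l l0 lH] := pd_lower_bound pdH.
set P := value_iteration k in IH; have pP : psdmx P := psd_value_iteration k.
pose Y t := N t + (L t)^T *m (s *: Pi P) *m L t.
have psP : psdmx (s *: Pi P) by apply: psdZ => //; apply: psd_Pi.
apply: (averages_lower (T0 := T0) (l := (1 - s) * l) (Y := Y)
  (M := H + mean_op T (s *: Pi P)) aS).
- by apply: mx_compensatedD => //; apply: mx_compensated_congr.
- by move=> t; apply: psdD => //; apply: psd_congr.
- exact: psd_Q.
- move=> t T0t; rewrite QS; have /andP[a0 a1] := aS.1 t.
  have -> (A B : 'M[R]_d) : A + a t *: (B - A) = (1 - a t) *: A + a t *: B.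
    by apply/matrixP => i j; rewrite !mxE; ring.
  apply: loewnerD; first exact: loewner_refl.
  apply: loewnerZ => //; apply: loewnerD; first exact: loewner_refl.
  apply: loewner_congr; apply: loewner_trans (Pi_scale_ge s0 pP) _.
  by apply: loewner_Pi; [apply: psdZ|apply: IH].
- by rewrite mulr_gt0 // subr_gt0.
- rewrite mean_opZ /value_iteration iterS -/(value_iteration k) -/P.
  have h : loewner_le ((1 - s) *: (l *: 1%:M)) ((1 - s) *: H).
    by apply: loewnerZ => //; rewrite subr_ge0 ltW.
  move: h; rewrite /loewner_le -scalerA; move: (l *: _) (mean_op _ _) => I A.
  suff -> : H + s *: A - (s *: (H + A) + (1 - s) *: I) =
    (1 - s) *: H - (1 - s) *: I by [].
  by apply/matrixP => i j; rewrite !mxE; ring.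
Qed.

(** The iterates are increasing and bounded, so some increment is below
    [H / 2], and the corresponding iterate is a supersolution. *)
Lemma bounded_supersolution M : (forall t, \tr (Q t) <= M) ->
  exists P, supersolution P.
Proof.
move=> QM; have [l l0 lH] := pd_lower_bound pdH.
have trM k : \tr (value_iteration k) <= 2 * M.
  have [|T0 /(_ T0 (leqnn _))/loewner_tr] := @value_iteration_liminf k 2^-1.
    by rewrite invr_ge0 ler0n /=; lra.
  by rewrite linearZ /=; have := QM T0; lra.
pose e := l / (2 * d.+1%:R).
have e0 : 0 < e by rewrite divr_gt0 // mulr_gt0 ?ltr0n.
have [k hk] : exists k, \tr (value_iteration k.+1) <= \tr (value_iteration k) + e.
  apply: contrapT => /forallNP h.
  have grow k : k%:R * e <= \tr (value_iteration k).
    elim: k => [|k IH]; first by rewrite mul0r; apply/psd_tr_ge0/psd_value_iteration.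
    have /negP := h k; rewrite -ltNge => /ltW; apply: le_trans.
    by rewrite -natr1 mulrDl mul1r lerD2r.
  have M0 : 0 <= 2 * M / e.
    rewrite divr_ge0 ?(ltW e0) // (le_trans _ (trM 0%N)) //.
    exact/psd_tr_ge0/psd_value_iteration.
  have := archi_boundP M0; set b := Num.bound _; rewrite ltr_pdivrMr // => hb.
  by have := le_lt_trans (le_trans (grow b) (trM b)) hb; rewrite ltxx.
exists (value_iteration k); split; first exact: psd_value_iteration.
have pD : psdmx (value_iteration k.+1 - value_iteration k) := value_iteration_le k.
have DH : loewner_le (value_iteration k.+1 - value_iteration k) (2^-1 *: H).
  apply: loewner_trans (psd_le_tr pD) _.
  apply: (@loewner_trans _ _ ((2^-1 * l) *: 1%:M)); last first.
    by rewrite -scalerA; apply: loewnerZ; rewrite // invr_ge0.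
  rewrite /loewner_le -scalerBl; apply: psdZ; last exact: psd1.
  rewrite linearB /= subr_ge0.
  apply: (@le_trans _ _ (d%:R * e)); first by rewrite ler_wpM2l // lerBlDl.
  have -> : d%:R * e = 2^-1 * l * (d%:R / d.+1%:R).
    by rewrite /e invfM; ring.
  rewrite ler_piMr ?mulr_ge0 ?invr_ge0 ?(ltW l0) // ler_pdivrMr ?ltr0n //.
  by rewrite mul1r ler_nat.
move: DH; rewrite /loewner_le {1}/value_iteration iterS -/(value_iteration k).
move: (value_iteration k) => P; move: (mean_op _ _) => A.
suff -> : 2^-1 *: H - (H + A - P) = P - (2^-1 *: H + A) by [].
by apply/matrixP => i j; rewrite !mxE; field.
Qed.

End Dichotomy.

(** * Measurability of the generalized Schur complement *)

Section MeasurableMatrices.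
Context {R : realType} {disp : measure_display} {S : measurableType disp}.

Definition mx_measurable p q (A : S -> 'M[R]_(p, q)) : Prop :=
  forall i j, measurable_fun setT (fun w => A w i j).

Lemma mx_measurableD p q (A B : S -> 'M[R]_(p, q)) :
  mx_measurable A -> mx_measurable B -> mx_measurable (fun w => A w + B w).
Proof.
by move=> mA mB i j; under eq_fun do rewrite mxE; apply: measurable_funD.
Qed.

Lemma mx_measurableM p q r (A : S -> 'M[R]_(p, q)) (B : S -> 'M[R]_(q, r)) :
  mx_measurable A -> mx_measurable B -> mx_measurable (fun w => A w *m B w).
Proof.
move=> mA mB i j; under eq_fun do rewrite mxE; apply: measurable_sum => k.
exact: measurable_funM.
Qed.

Lemma mx_measurableZ p q (c : S -> R) (A : S -> 'M[R]_(p, q)) : measurable_fun setT c ->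
  mx_measurable A -> mx_measurable (fun w => c w *: A w).
Proof.
by move=> mc mA i j; under eq_fun do rewrite mxE; apply: measurable_funM.
Qed.

Lemma mx_measurableB p q (A B : S -> 'M[R]_(p, q)) :
  mx_measurable A -> mx_measurable B -> mx_measurable (fun w => A w - B w).
Proof.
by move=> mA mB i j; under eq_fun do rewrite !mxE; apply: measurable_funB.
Qed.

Lemma mx_measurable_tr p q (A : S -> 'M[R]_(p, q)) :
  mx_measurable A -> mx_measurable (fun w => (A w)^T).
Proof. by move=> mA i j; under eq_fun do rewrite mxE; apply: mA. Qed.

Lemma mx_measurable_cst p q (A : 'M[R]_(p, q)) : mx_measurable (fun=> A).
Proof. by move=> i j; apply: measurable_cst. Qed.

Lemma measurable_det p (A : S -> 'M[R]_p) :
  mx_measurable A -> measurable_fun setT (fun w => \det (A w)).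
Proof.
move=> mA; rewrite /determinant; apply: measurable_sum => s.
apply: measurable_funM => //; apply: measurable_prod => i _; exact: mA.
Qed.

Lemma measurable_funV (f : S -> R) : (forall w, f w != 0) ->
  measurable_fun setT f -> measurable_fun setT (fun w => (f w)^-1).
Proof.
move=> f0 mf; have o0 : open (~` [set (0 : R)]).
  by rewrite openC; apply: accessible_closed_set1; apply: hausdorff_accessible.
apply: (@measurable_comp _ _ _ _ _ _ (~` [set (0 : R)]) (@GRing.inv R)) => //.
- exact: open_measurable.
- by move=> _ [w _ <-]; apply/eqP.
- apply: open_continuous_measurable_fun => //; apply/in_setP => x /= /eqP x0.
  exact: inv_continuous.
Qed.

Lemma mx_measurable_inv p (A : S -> 'M[R]_p) : (forall w, A w \in unitmx) ->
  mx_measurable A -> mx_measurable (fun w => invmx (A w)).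
Proof.
move=> uA mA i j.
under eq_fun do rewrite /invmx uA !mxE /cofactor.
apply: measurable_funM.
  apply: measurable_funV; last exact: measurable_det.
  by move=> w; have := uA w; rewrite unitmxE unitfE.
apply: measurable_funM => //; apply: measurable_det.
by move=> k l; under eq_fun do rewrite !mxE; apply: mA.
Qed.

End MeasurableMatrices.

Section MeasurablePi.
Context {R : realType} {n m : nat}.

Lemma mppinv_unit p (A : 'M[R]_p) : A \in unitmx -> mppinv A = invmx A.
Proof.
move=> uA; apply: penrose_uniq (mppinvP A) _.
by split; rewrite ?mulmxV ?mulVmx ?mul1mx ?trmx1.
Qed.

(** Adding a positive multiple makes the control block definite and leaves the
    other blocks unchanged. *)
Definition ridge : 'M[R]_(n + m) := block_mx 0 0 0 1%:M.

Lemma psd_ridge : psdmx ridge.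
Proof.
have := psd_congr (row_mx (0 : 'M[R]_(m, n)) 1%:M) (psd1 m : psdmx (1%:M : 'M[R]_m)).
by rewrite mulmx1 tr_row_mx trmx0 trmx1 mul_col_row !mul0mx mulmx0 mulmx1.
Qed.

Lemma pd_add_ridge p (A : 'M[R]_p) e : psdmx A -> 0 < e -> pdmx (A + e *: 1%:M).
Proof.
move=> pA e0; have pI : psdmx (1%:M : 'M[R]_p) := psd1 p.
split=> [|x x0]; first by rewrite linearD linearZ /= (psd_sym pA) trmx1.
rewrite -/(qform _ x) qformD qformZ ltr_wpDl ?psd_qform // mulr_gt0 //.
rewrite lt0r (psd_qform x pI) andbT.
apply: contra x0; rewrite qform1 psumr_eq0 => [/allP h|i _]; last exact: sqr_ge0.
apply/eqP/colP => i; have := h i (mem_index_enum _).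
by rewrite /= sqrf_eq0 => /eqP ->; rewrite mxE.
Qed.

(** [Pi] is squeezed between its values at [Q] and at [Q + e ridge], where the
    control block is invertible and [Pi] is a rational function. *)
Lemma Pi_ridge_cvg (Q : 'M[R]_(n + m)) i j : psdmx Q ->
  (fun k => Pi (Q + k.+1%:R^-1 *: ridge) i j) @ \oo --> Pi Q i j.
Proof.
move=> pQ; pose F := feedback_cost (optimal_gain Q) ridge.
have pF : psdmx F by apply/psd_feedback_cost/psd_ridge.
have hk k : `|Pi Q i j - Pi (Q + k.+1%:R^-1 *: ridge) i j| <= k.+1%:R^-1 * \tr F.
  have e0 : 0 <= k.+1%:R^-1 :> R by rewrite invr_ge0.
  have pR := psdZ e0 psd_ridge.
  have QQ : loewner_le Q (Q + k.+1%:R^-1 *: ridge).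
    by rewrite /loewner_le addrAC subrr add0r.
  have h1 := loewner_Pi pQ QQ.
  have h2 := Pi_le_feedback_cost (optimal_gain Q) (psdD pQ pR).
  rewrite feedback_costD feedback_costZ feedback_cost_optimal // in h2.
  have h3 : loewner_le (Pi (Q + k.+1%:R^-1 *: ridge) - Pi Q) (k.+1%:R^-1 *: F).
    move: h2; rewrite /loewner_le; congr psdmx.
    by apply/matrixP => x y; rewrite !mxE; ring.
  have := psd_entry_le_tr i j h1; rewrite !mxE distrC => /le_trans; apply.
  by have := loewner_tr h3; rewrite [\tr (_ *: _)]linearZ.
apply/cvgrPdist_le => e e0.
have c0 : 0 <= \tr F / e by rewrite divr_ge0 ?(ltW e0) ?psd_tr_ge0.
exists (Num.bound (\tr F / e)) => // k /= bk.
apply: le_trans (hk k) _; rewrite ler_pdivrMl ?ltr0n // -ler_pdivrMr //.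
apply: le_trans (ltW (archi_boundP c0)) _; rewrite ler_nat.
exact: leqW.
Qed.

Lemma mx_measurable_Pi disp (S : measurableType disp) (Q : S -> 'M[R]_(n + m)) :
  (forall w, psdmx (Q w)) -> mx_measurable Q -> mx_measurable (fun w => Pi (Q w)).
Proof.
move=> pQ mQ i j.
apply: (measurable_fun_cvg (h := fun k w => Pi (Q w + k.+1%:R^-1 *: ridge) i j)); last first.
  by move=> w _; apply: Pi_ridge_cvg.
move=> k; have e0 : 0 < k.+1%:R^-1 :> R by rewrite invr_gt0 ltr0n.
have drE w : drsubmx (Q w + k.+1%:R^-1 *: ridge) = drsubmx (Q w) + k.+1%:R^-1 *: 1%:M.
  by rewrite -{1}(submxK (Q w)) scale_block_mx add_block_mx block_mxKdr.
have uQ w : drsubmx (Q w) + k.+1%:R^-1 *: 1%:M \in unitmx.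
  by apply/pd_unit/pd_add_ridge => //; apply: psd_dr.
have mA : mx_measurable (fun w => Q w + k.+1%:R^-1 *: ridge).
  by apply: mx_measurableD => //; apply: mx_measurable_cst.
have mblock : [/\ mx_measurable (fun w => ulsubmx (Q w + k.+1%:R^-1 *: ridge)),
   mx_measurable (fun w => ursubmx (Q w + k.+1%:R^-1 *: ridge)),
   mx_measurable (fun w => dlsubmx (Q w + k.+1%:R^-1 *: ridge)) &
   mx_measurable (fun w => drsubmx (Q w + k.+1%:R^-1 *: ridge))].
  by split=> x y; under eq_fun do rewrite !mxE; apply: measurable_funD.
have [mul mur mdl mdr] := mblock.
have : mx_measurable (fun w => Pi (Q w + k.+1%:R^-1 *: ridge)); last exact.
rewrite /Pi; apply: mx_measurableB => //; apply: mx_measurableM => //.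
apply: mx_measurableM => //.
under eq_fun do rewrite mppinv_unit ?drE //.
apply: mx_measurable_inv => //.
by under eq_fun do rewrite -drE.
Qed.

End MeasurablePi.

(** * Integrals over independent maps *)

Section IndependentProduct.
Context {R : realType} {disp : measure_display} {Omega : measurableType disp}.
Variable P : probability Omega R.
Local Open Scope ereal_scope.

Definition independent_maps d1 d2 (S1 : measurableType d1) (S2 : measurableType d2)
    (W : Omega -> S1) (Z : Omega -> S2) : Prop :=
  forall A B, measurable A -> measurable B ->
    P (W @^-1` A `&` Z @^-1` B) = P (W @^-1` A) * P (Z @^-1` B).

(** The joint law of independent maps is the product of their laws, so a
    nonnegative function of both is integrated one map at a time. *)
Lemma independent_integral d1 d2 (S1 : measurableType d1) (S2 : measurableType d2)
    (W : Omega -> S1) (Z : Omega -> S2) (f : S1 * S2 -> \bar R) :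
  measurable_fun setT W -> measurable_fun setT Z -> independent_maps W Z ->
  measurable_fun setT f -> (forall x, 0 <= f x) ->
  \int[P]_w f (W w, Z w) = \int[P]_w \int[P]_v f (W w, Z v).
Proof.
move=> mW mZ WZ mf f0.
pose W' : {mfun Omega >-> S1} := HB.pack W (isMeasurableFun.Build _ _ _ _ W mW).
pose Z' : {mfun Omega >-> S2} := HB.pack Z (isMeasurableFun.Build _ _ _ _ Z mZ).
have mWZ : measurable_fun setT (fun w => (W w, Z w)) by exact: measurable_fun_pair.
pose V : {mfun Omega >-> (S1 * S2)%type} :=
  HB.pack (fun w => (W w, Z w)) (isMeasurableFun.Build _ _ _ _ _ mWZ).
have -> : \int[P]_w f (W w, Z w) = \int[distribution P V]_x f x.
  by rewrite ge0_integral_distribution.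
rewrite (eq_measure_integral (distribution P W' \x distribution P Z')%E); last first.
  move=> A mA _; apply/esym; exact: product_measure_unique.
rewrite fubini_tonelli1 //.
rewrite (@ge0_integral_distribution _ _ _ _ _ P W'); last 2 first.
- exact: measurable_fun_fubini_tonelli_F.
- by move=> x; apply: integral_ge0.
apply: eq_integral => w _ /=; rewrite /fubini_F ge0_integral_distribution //.
exact: measurable_fun_pair2.
Qed.

(** A centred factor that is independent of the rest leaves no cross term. *)
Lemma independent_centred_square (s g : Omega -> R) (Z : Omega -> R) :
  measurable_fun setT s -> measurable_fun setT g -> measurable_fun setT Z ->
  independent_maps (fun w => (s w, g w)) Z ->
  \int[P]_w (Z w ^+ 2)%:E < +oo -> \int[P]_w (Z w)%:E = 0 ->
  \int[P]_w ((s w + g w * Z w) ^+ 2)%:E =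
  \int[P]_w (s w ^+ 2)%:E + \int[P]_w (Z w ^+ 2)%:E * \int[P]_w (g w ^+ 2)%:E.
Proof.
move=> ms mg mZ indep Z2oo Z0.
have mZ2 : measurable_fun setT (fun w => (Z w ^+ 2)%:E).
  by apply/measurable_EFinP; apply: measurable_funX.
have iZ2 : P.-integrable setT (fun w => (Z w ^+ 2)%:E).
  apply/integrableP; split=> //.
  rewrite (eq_integral (fun w => (Z w ^+ 2)%:E)) // => w _.
  by rewrite gee0_abs // lee_fin sqr_ge0.
have i1 : P.-integrable setT (fun w => 1%:E : \bar R).
  exact: finite_measure_integrable_cst.
have iZ : P.-integrable setT (fun w => (Z w)%:E).
  apply: (le_integrable _ _ _ (integrableD measurableT i1 iZ2)) => //.
    exact/measurable_EFinP.
  move=> w _; change (`|(Z w)%:E| <= `|(1 + Z w ^+ 2)%R%:E|).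
  rewrite !abse_EFin lee_fin.
  rewrite (@ger0_norm _ (1 + _)%R) ?addr_ge0 ?sqr_ge0 //.
  have := sqr_ge0 (Z w - 1); have := sqr_ge0 (Z w + 1).
  by rewrite ler_norml; lra.
have s2fin : exists2 v, \int[P]_w (Z w ^+ 2)%:E = v%:E & (0 <= v)%R.
  have p0 : 0 <= \int[P]_w (Z w ^+ 2)%:E by apply: integral_ge0 => w _; rewrite lee_fin sqr_ge0.
  exists (fine (\int[P]_w (Z w ^+ 2)%:E)); last exact: fine_ge0.
  by rewrite fineK // ge0_fin_numE.
have [v vE v0] := s2fin.
pose f (x : (R * R) * R) := ((x.1.1 + x.1.2 * x.2) ^+ 2)%:E.
have mf : measurable_fun setT f.
  apply/measurable_EFinP; apply: measurable_funX; apply: measurable_funD.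
    exact: measurableT_comp measurable_fst measurable_fst.
  apply: measurable_funM; last exact: measurable_snd.
  exact: measurableT_comp measurable_snd measurable_fst.
have msg : measurable_fun setT (fun w => (s w, g w)) by exact: measurable_fun_pair.
have := independent_integral msg mZ indep mf (fun x => _).
rewrite /f /= => ->; last by move=> x; rewrite lee_fin sqr_ge0.
have inner a b : \int[P]_w ((a + b * Z w) ^+ 2)%:E = (a ^+ 2 + v * b ^+ 2)%:E.
  have E w : ((a + b * Z w) ^+ 2)%:E =
      (a ^+ 2)%:E * 1%:E + ((2 * a * b)%:E * (Z w)%:E + (b ^+ 2)%:E * (Z w ^+ 2)%:E).
    by rewrite -!EFinM -!EFinD; congr (_%:E); ring.
  under eq_integral do rewrite E.
  rewrite integralD //; last 2 first.
  - exact: integrableZl.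
  - by apply: integrableD => //; exact: integrableZl.
  rewrite integralD //; last 2 first.
  - exact: integrableZl.
  - exact: integrableZl.
  rewrite !integralZl // Z0 vE mule0 add0e.
  rewrite (_ : \int[P]_w 1%:E = 1) ?integral_cst ?probability_setT ?mule1 //.
  by rewrite -EFinM -EFinD mulrC.
  by have := integral_cst P measurableT 1%:E; rewrite /= probability_setT mule1.
under eq_integral do rewrite inner.
have E w : (s w ^+ 2 + v * g w ^+ 2)%:E = (s w ^+ 2)%:E + v%:E * (g w ^+ 2)%:E by [].
under eq_integral do rewrite E.
rewrite ge0_integralD //; last 4 first.
- by move=> w _; rewrite lee_fin sqr_ge0.
- by apply/measurable_EFinP; apply: measurable_funX.
- by move=> w _; rewrite mule_ge0 ?lee_fin ?sqr_ge0.
- by apply/measurable_EFinP; apply: measurable_funM => //; apply: measurable_funX.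
rewrite ge0_integralZl ?vE ?lee_fin //.
- by apply/measurable_EFinP; apply: measurable_funX.
- by move=> w _; rewrite lee_fin sqr_ge0.
Qed.

End IndependentProduct.

(** * Martingale transforms of independent observations *)

Section Past.
Context {R : realType} {disp : measure_display} {Omega : measurableType disp}.
Variable P : probability Omega R.
Context {d' : measure_display} {S : measurableType d'}.
Variable X : nat -> Omega -> S.
Hypothesis mX : forall t, (1 <= t)%N -> measurable_fun setT (X t).
Hypothesis indX : mutually_independent P [set t | (1 <= t)%N] X.

(** Finite intersections of events of the observations up to time [t]: a
    generating pi-system of the filtration. *)
Definition cylinders t : set (set Omega) :=
  [set A | exists2 E : nat -> set Omega,
     (forall s, (1 <= s <= t)%N -> g_sigma_algebra_preimage (X s) (E s)) &
     A = \bigcap_(s in [set s | (1 <= s <= t)%N]) E s].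

Lemma preimage_measurable s A : (1 <= s)%N ->
  g_sigma_algebra_preimage (X s) A -> measurable A.
Proof. by move=> s1 [B mB <-]; apply: mX. Qed.

Lemma cylinder_measurable t : cylinders t `<=` measurable.
Proof.
move=> A [E hE ->]; apply: bigcap_measurableType.
by move=> s /= /andP[s1 st]; apply: (preimage_measurable s1); apply: hE; rewrite s1.
Qed.

Lemma cylinders_setI t : setI_closed (cylinders t).
Proof.
move=> A B [E hE ->] [F hF ->]; exists (fun s => E s `&` F s).
  move=> s st; have [[U mU <-] [V mV <-]] := (hE s st, hF s st).
  by exists (U `&` V); [exact: measurableI|rewrite !setTI preimage_setI].
by rewrite bigcapI.
Qed.

Lemma filtration_cylinders t : filtration X t `<=` <<s cylinders t >>.
Proof.
apply: smallest_sub; first exact: smallest_sigma_algebra.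
move=> A [s /= /andP[s1 st] sA]; apply: sub_sigma_algebra.
exists (fun r => if r == s then A else setT).
  move=> r _; case: eqP => [->//|_].
  by exists setT => //; rewrite preimage_setT setTI.
apply/seteqP; split=> [w Aw r _|w /(_ s)]; first by case: eqP.
by rewrite /= s1 st eqxx; apply.
Qed.

Lemma filtration_measurable t : filtration X t `<=` measurable.
Proof.
move=> A /filtration_cylinders; apply: smallest_sub.
  exact: sigma_algebra_measurable.
exact: cylinder_measurable.
Qed.

Lemma independent_cylinder t A B : cylinders t A ->
  g_sigma_algebra_preimage (X t.+1) B -> P (A `&` B) = (P A * P B)%E.
Proof.
move=> [E hE ->] hB.
pose F s := if (s <= t)%N then E s else B.
pose J := fix J t : {fset nat} := if t is t'.+1 then (t'.+1 |` J t')%fset else fset0.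
have JP r s : (s \in J r) = (1 <= s <= r)%N.
  elim: r => [|r IH] /=; first by rewrite in_fset0; case: s.
  by rewrite in_fset1U IH [(s <= _.+1)%N]leq_eqVlt ltnS; case: eqP => [->|].
have JE r : [set` J r] = [set s | (1 <= s <= r)%N].
  by apply/seteqP; split=> s /=; rewrite JP.
have FX r : (r <= t.+1)%N -> forall s, s \in J r ->
    (1 <= s)%N /\ g_sigma_algebra_preimage (X s) (F s).
  move=> rt s; rewrite JP => /andP[s1 sr]; split=> //.
  rewrite /F; case: leqP => st; first by apply: hE; rewrite s1.
  by have -> : s = t.+1 by apply/eqP; rewrite eqn_leq st (leq_trans sr).
have FE s : (s <= t)%N -> F s = E s by move=> st; rewrite /F st.
have capE : \bigcap_(s in [set` J t]) F s =
    \bigcap_(s in [set s | (1 <= s <= t)%N]) E s.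
  by rewrite JE; apply: eq_bigcapr => s /= /andP[_ st]; rewrite FE.
have h1 := indX (FX t (leqnSn t)); have h2 := indX (FX t.+1 (leqnn _)).
rewrite -capE h1.
have -> : \bigcap_(s in [set` J t]) F s `&` B = \bigcap_(s in [set` J t.+1]) F s.
  rewrite !JE; apply/seteqP; split=> w /=.
    move=> [h Bw] s /= /andP[s1]; rewrite leq_eqVlt => /orP[/eqP ->|].
      by rewrite /F ltnn.
    by rewrite ltnS => st; apply: h => /=; rewrite s1.
  move=> h; split; first by move=> s /= /andP[s1 st]; apply: h; rewrite /= s1 leqW.
  by have := h t.+1; rewrite /F ltnn; apply; rewrite /= leqnn.
rewrite h2 /= big_fsetU1 /=; last by rewrite JP ltnn andbF.
by rewrite {1}/F ltnn muleC.
Qed.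

(** Both sides are finite measures of [A] that agree on the cylinders. *)
Lemma independent_past t A B : filtration X t A ->
  g_sigma_algebra_preimage (X t.+1) B -> P (A `&` B) = (P A * P B)%E.
Proof.
move=> /filtration_cylinders FA hB; have mB := preimage_measurable (ltn0Sn t) hB.
have PB : P B = (fine (P B))%:E by rewrite fineK // fin_num_measure.
have PB0 : 0 <= fine (P B) by apply: fine_ge0.
pose m1 : {measure set Omega -> \bar R} := mrestr P mB.
pose m2 : {measure set Omega -> \bar R} := mscale (NngNum PB0) P.
have T t' : cylinders t' setT.
  by exists (fun=> setT) => [s _|]; [exists setT; rewrite ?preimage_setT ?setTI|rewrite bigcapT].
have : m1 A = m2 A.
  apply: (g_sigma_algebra_measure_unique (cylinders t) _ (fun=> setT)) => //.
  - exact: cylinder_measurable.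
  - by rewrite bigcup_const.
  - exact: cylinders_setI.
  - move=> C cC; rewrite /m1 /m2 /= /mrestr /mscale /= -PB muleC.
    exact: independent_cylinder cC hB.
  - move=> _; rewrite /m1 /= /mrestr.
    apply: le_lt_trans (probability_le1 P _) _ => //; last exact: ltry.
    exact: measurableI.
by rewrite /m1 /m2 /= /mrestr /mscale /= -PB muleC.
Qed.

Definition adapted t (f : Omega -> R) : Prop :=
  forall B, measurable B -> filtration X t (f @^-1` B).

(** The filtration at time [t] as the measurable sets of a type, so that closure
    properties of measurable functions apply to adapted ones. *)
Definition past t := g_sigma_algebraType
  (\bigcup_(s in [set s | (1 <= s <= t)%N]) g_sigma_algebra_preimage (X s)).

Lemma adaptedP t f : adapted t f <-> measurable_fun setT (f : past t -> R).
Proof.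
split=> [h _ B mB|h B mB]; first by rewrite setTI; exact: h.
by have := h measurableT B mB; rewrite setTI.
Qed.

Lemma adapted_measurable t f : adapted t f -> measurable_fun setT f.
Proof. by move=> h _ B mB; rewrite setTI; apply: filtration_measurable (h B mB). Qed.

Lemma filtration_le s t : (s <= t)%N -> filtration X s `<=` filtration X t.
Proof.
move=> st; apply: smallest_sub; first exact: smallest_sigma_algebra.
move=> A [r /= /andP[r1 rs] hA]; apply: sub_sigma_algebra.
by exists r => //=; rewrite r1 (leq_trans rs).
Qed.

Lemma adapted_le s t f : (s <= t)%N -> adapted s f -> adapted t f.
Proof. by move=> st h B mB; apply: filtration_le st _ (h B mB). Qed.

Lemma adapted_obs t (h : S -> R) : (1 <= t)%N -> measurable_fun setT h ->
  adapted t (fun w => h (X t w)).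
Proof.
move=> t1 mh B mB; apply: sub_sigma_algebra; exists t => /=; first by rewrite t1 leqnn.
by exists (h @^-1` B); [rewrite -[X in measurable X]setTI; exact: mh|rewrite setTI].
Qed.

Section Isometry.
Variables (h : S -> R) (mu : R).
Hypothesis mh : measurable_fun setT h.
Let Z t w := h (X t.+1 w) - mu.
Variable v : \bar R.
Hypothesis Z0 : forall t, (\int[P]_w (Z t w)%:E = 0)%E.
Hypothesis Zv : forall t, (\int[P]_w (Z t w ^+ 2)%:E = v)%E.
Hypothesis voo : (v < +oo)%E.

Lemma measurable_noise t : measurable_fun setT (Z t).
Proof. by apply: measurable_funB => //; apply: measurableT_comp => //; apply: mX. Qed.

Lemma adapted_noise t : adapted t.+1 (Z t).
Proof.
by apply: adapted_obs (fun x => h x - mu) _ _ => //; apply: measurable_funB.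
Qed.

Lemma adapted_martingale (g : nat -> Omega -> R) t :
  (forall s, (s < t)%N -> adapted s (g s)) ->
  adapted t (fun w => series (fun s => g s w * Z s w) t).
Proof.
move=> ag; apply/adaptedP.
rewrite (_ : (fun w => _) = fun w => \sum_(s < t) g s w * Z s w); last first.
  by apply/funext => w; rewrite /series /= big_mkord.
apply: measurable_sum => i; apply: measurable_funM; apply/adaptedP.
  by apply: adapted_le (ag i (ltn_ord i)); apply: ltnW.
by apply: adapted_le (ltn_ord i) _; apply: adapted_noise.
Qed.

(** The increments [g s * Z s] are orthogonal in [L^2]. *)
Lemma martingale_square (g : nat -> Omega -> R) t :
  (forall s, adapted s (g s)) ->
  (\int[P]_w (series (fun s => g s w * Z s w) t ^+ 2)%:E =
   v * \sum_(0 <= s < t) \int[P]_w (g s w ^+ 2)%:E)%E.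
Proof.
move=> ag; elim: t => [|t IH].
  rewrite big_nil mule0; apply: integral0_eq => w _.
  by rewrite /series /= big_nil expr0n.
under eq_integral do rewrite seriesSr /=.
have ams := adapted_martingale (t := t) (fun s _ => ag s).
rewrite independent_centred_square.
- have g0 s : (0 <= \int[P]_w (g s w ^+ 2)%:E)%E.
    by apply: integral_ge0 => w _; rewrite lee_fin sqr_ge0.
  rewrite IH Zv big_nat_recr //.
  by apply/esym/ge0_muleDr => //; apply: sume_ge0.
- exact: adapted_measurable ams.
- exact: adapted_measurable (ag t).
- exact: measurable_noise.
- move=> A B mA mB; apply: (independent_past (t := t)).
    have : measurable_fun setT ((fun w => (series (fun s => g s w * Z s w) t, g t w))
        : past t -> (R * R)%type).
      by apply: measurable_fun_pair; apply/adaptedP.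
    by move=> /(_ measurableT A mA); rewrite setTI.
  exists ((fun x => h x - mu) @^-1` B); last by rewrite setTI.
  by rewrite -[X in measurable X]setTI; apply: measurable_funB.
- by rewrite Zv.
- exact: Z0.
Qed.

Local Open Scope ereal_scope.

Definition partial_sum (g : nat -> Omega -> R) t w : R :=
  series (fun s => g s w * Z s w)%R t.

Lemma measurable_exceedance (A : set nat) (g : nat -> Omega -> R) (e : R) :
  (forall s, adapted s (g s)) ->
  measurable [set w | exists2 k, A k & (e < `|partial_sum g k w|)%R].
Proof.
move=> ag; have -> : [set w | exists2 k, A k & (e < `|partial_sum g k w|)%R] =
    \bigcup_(k in A) ~` [set w | (`|partial_sum g k w| <= e)%R].
  apply/seteqP; split=> w [k Ak ke]; exists k => //=; first by apply/negP; rewrite -ltNge.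
  by rewrite ltNge; apply/negP.
apply: bigcup_measurable => k _; apply: measurableC; rewrite -[X in measurable X]setTI.
apply: measurable_fun_le => //; apply: measurableT_comp => //.
by apply: (adapted_measurable (t := k)); apply: adapted_martingale => r _; apply: ag.
Qed.

(** Freezing the partial sums when they first exceed [e] turns the bound on the
    last partial sum into a bound on the maximum. *)
Lemma maximal_inequality (g : nat -> Omega -> R) (e : R) t :
  (forall s, adapted s (g s)) -> (0 < e)%R ->
  (e ^+ 2)%:E * P [set w | exists2 k, (k <= t)%N & (e < `|partial_sum g k w|)%R] <=
  v * \sum_(0 <= s < t) \int[P]_w (g s w ^+ 2)%:E.
Proof.
move=> ag e0; pose ok s := [set w | (`|partial_sum g s w| <= e)%R].
pose f s w := (g s w * \prod_(j < s.+1) \1_(ok j) w)%R.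
have aM s : adapted s (partial_sum g s) by apply: adapted_martingale => r _; apply: ag.
have af s : adapted s (f s).
  apply/adaptedP; apply: measurable_funM; first exact/adaptedP.
  apply: measurable_prod => j _; apply: measurable_indic.
  have mMj : measurable_fun setT (partial_sum g j : past s -> R).
    by apply/adaptedP; apply: adapted_le (aM j); rewrite -ltnS.
  rewrite -[X in measurable X]setTI.
  by apply: measurable_fun_le => //; exact: measurableT_comp.
have fg s w : (f s w ^+ 2 <= g s w ^+ 2)%R.
  rewrite /f exprMn ler_piMr ?sqr_ge0 // -prodrXl.
  apply: prodr_ile1 => j _.
  by rewrite indicE; case: (_ \in _); rewrite /= ?expr1n ?expr0n /= ?lexx ?ler01.
set W := [set w | _].
have WE w : W w -> (e < `|partial_sum f t w|)%R.
  move=> [k0 k0t k0e].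
  have ex : exists k, (e < `|partial_sum g k w|)%R by exists k0.
  case: (ex_minnP ex) => k ke kmin.
  have kt : (k <= t)%N by apply: leq_trans (kmin _ k0e) k0t.
  suff -> : partial_sum f t w = partial_sum g k w by [].
  rewrite /partial_sum /series /= (big_cat_nat (n := k)) //=.
  rewrite [X in (_ + X)%R]big_nat_cond [X in (_ + X)%R]big1 ?addr0.
    rewrite big_nat_cond [RHS]big_nat_cond; apply: eq_bigr => s /andP[/andP[_ sk] _].
    rewrite /f big1 ?mulr1 // => j _; rewrite indicE.
    rewrite mem_set // /ok /= leNgt; apply/negP => /kmin; apply/negP; rewrite -ltnNge.
    by apply: leq_trans (ltn_ord j) sk.
  move=> s /andP[/andP[ks _] _].
  have kS : (k < s.+1)%N by [].
  rewrite /f (bigD1 (Ordinal kS)) //= indicE memNset ?mul0r ?mulr0 ?mul0r //.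
  by rewrite /ok /=; apply/negP; rewrite -ltNge.
have mMf : measurable_fun setT (fun w => (partial_sum f t w ^+ 2)%:E).
  apply/measurable_EFinP/measurable_funX.
  by apply: (adapted_measurable (t := t)); apply: adapted_martingale => r _; apply: af.
have mW : measurable W by apply: (measurable_exceedance [set k | (k <= t)%N]).
have f2 w : 0 <= (partial_sum f t w ^+ 2)%:E by rewrite lee_fin sqr_ge0.
have v0 : 0 <= v by rewrite -(Zv 0); apply: integral_ge0 => w _; rewrite lee_fin sqr_ge0.
rewrite -integral_cst //.
apply: (@le_trans _ _ (\int[P]_(w in W) (partial_sum f t w ^+ 2)%:E)).
  apply: ge0_le_integral => //.
  - by move=> w _; rewrite lee_fin sqr_ge0.
  - exact: measurable_funTS.
  - move=> w /WE hw; rewrite lee_fin -[leRHS]real_normK ?num_real //.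
    by rewrite lerXn2r ?nnegrE ?(ltW e0) // ltW.
apply: (@le_trans _ _ (\int[P]_w (partial_sum f t w ^+ 2)%:E)).
  exact: ge0_subset_integral.
rewrite martingale_square //; apply: lee_wpmul2l => //.
apply: lee_sum => s _; apply: ge0_le_integral => //.
- by move=> w _; rewrite lee_fin sqr_ge0.
- by apply/measurable_EFinP/measurable_funX/(adapted_measurable (af s)).
- by apply/measurable_EFinP/measurable_funX/(adapted_measurable (ag s)).
- by move=> w _; rewrite lee_fin.
Qed.

Lemma maximal_inequality_sup (g : nat -> Omega -> R) (e c : R) :
  (forall s, adapted s (g s)) -> (0 < e)%R ->
  (forall t, \sum_(0 <= s < t) \int[P]_w (g s w ^+ 2)%:E <= c%:E) ->
  P [set w | exists2 k, True & (e < `|partial_sum g k w|)%R] <=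
  ((e ^+ 2)^-1)%:E * (v * c%:E).
Proof.
move=> ag e0 gc.
have v0 : 0 <= v by rewrite -(Zv 0); apply: integral_ge0 => w _; rewrite lee_fin sqr_ge0.
pose W t := [set w | exists2 k, (k <= t)%N & (e < `|partial_sum g k w|)%R].
have -> : [set w | exists2 k, True & (e < `|partial_sum g k w|)%R] = \bigcup_t W t.
  by apply/seteqP; split=> w [k]; [move=> _ ke; exists k => //; exists k|move=> _ [j _ je]; exists j].
have mW t : measurable (W t) by apply: (measurable_exceedance [set k | (k <= t)%N]).
have Wcvg : (P \o W) @ \oo --> P (\bigcup_t W t).
  apply: nondecreasing_cvg_mu => //; first exact: bigcupT_measurable.
  move=> i j ij; apply/subsetPset => w [k ki ke]; exists k => //.
  exact: leq_trans ij.
apply: (cvge_to_le Wcvg); near=> t => /=.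
rewrite lee_pdivlMl ?exprn_gt0 //; apply: le_trans (maximal_inequality t ag e0) _.
exact: lee_wpmul2l.
Unshelve. all: by end_near.
Qed.

(** By the maximal inequality, the partial sums move by more than [e] after time
    [T] with a probability that vanishes with the tail of [sum E (g s ^ 2)]; hence
    almost surely they form a Cauchy sequence. *)
Lemma series_square_cvg (g : nat -> Omega -> R) (C : R) :
  (forall s, adapted s (g s)) ->
  (forall w t, (series (fun s => g s w ^+ 2) t <= C)%R) ->
  {ae P, forall w, cvgn (series (fun s => g s w * Z s w)%R)}.
Proof.
move=> ag gC.
have mg2 s : measurable_fun setT (fun w => (g s w ^+ 2)%:E).
  exact/measurable_EFinP/measurable_funX/(adapted_measurable (ag s)).
have g20 s w : 0 <= (g s w ^+ 2)%:E by rewrite lee_fin sqr_ge0.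
have b0 s : 0 <= \int[P]_w (g s w ^+ 2)%:E by apply: integral_ge0.
have sumC t : \sum_(0 <= s < t) \int[P]_w (g s w ^+ 2)%:E <= C%:E.
  rewrite -ge0_integral_sum //.
  have -> : C%:E = \int[P]_w (cst C%:E w).
    by have := integral_cst P measurableT C%:E; rewrite /= probability_setT mule1.
  apply: ge0_le_integral => //.
  - by move=> w _; apply: sume_ge0.
  - exact: emeasurable_sum.
  - by move=> w _; rewrite sumEFin lee_fin; apply: gC.
have [B BE] : exists B : nat -> R, forall s, \int[P]_w (g s w ^+ 2)%:E = (B s)%:E.
  exists (fun s => fine (\int[P]_w (g s w ^+ 2)%:E)) => s; rewrite fineK //.
  rewrite ge0_fin_numE //; apply: le_lt_trans (ltry C).
  apply: le_trans (sumC s.+1); rewrite big_nat_recr // leeDr //; exact: sume_ge0.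
have B0 s : (0 <= B s)%R by rewrite -lee_fin -BE.
have BC t : (series B t <= C)%R.
  by rewrite -lee_fin -sumEFin; under eq_bigr do rewrite -BE.
have Bnd : nondecreasing_seq (series B).
  by apply: nondecreasing_series => k _ _; exact: B0.
have [vr vE] : exists vr : R, v = vr%:E.
  exists (fine v); rewrite fineK // ge0_fin_numE // -(Zv 0).
  by apply: integral_ge0 => w _; rewrite lee_fin sqr_ge0.
have vr0 : (0 <= vr)%R.
  by rewrite -lee_fin -vE -(Zv 0); apply: integral_ge0 => w _; rewrite lee_fin sqr_ge0.
have tail (d : R) : (0 < d)%R ->
    exists T, forall t, (\sum_(T <= s < t) B s <= d)%R.
  move=> d0.
  have /nondecreasing_is_cvgn-/(_ Bnd) : has_ubound (range (series B)).
    by exists C => _ [t _ <-].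
  move=> cB; have /cvgrPdist_le/(_ d d0)[T _ hT] := cB; exists T => t.
  have [tT|Tt] := leqP t T; first by rewrite big_geq // ltW.
  have := hT T (leqnn T); rewrite /= ler_norml => /andP[_ h1].
  have := nondecreasing_cvgn_le Bnd cB t => h2.
  have : (series B t = series B T + \sum_(T <= s < t) B s)%R.
    by rewrite /series /= -big_cat_nat //= ltnW.
  lra.
pose gT T s w := if (T <= s)%N then g s w else 0%R.
have agT T s : adapted s (gT T s).
  rewrite /gT; case: leqP => _; first exact: ag.
  by apply/adaptedP; exact: measurable_cst.
pose D (e : R) T := [set w | exists2 k, True & (e < `|partial_sum (gT T) k w|)%R].
have mD e T : measurable (D e T) by apply: (measurable_exceedance setT).
have PD (e : R) : (0 < e)%R -> P (\bigcap_T D e T) = 0.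
  move=> e0; apply/eqP; rewrite eq_le measure_ge0 andbT.
  apply/lee_addgt0Pr => d d0; rewrite add0e.
  have d'0 : (0 < d * e ^+ 2 / (vr + 1))%R.
    by rewrite divr_gt0 ?mulr_gt0 ?exprn_gt0 //; lra.
  have [T hT] := tail _ d'0.
  apply: (@le_trans _ _ (P (D e T))).
    by apply: le_measure; rewrite ?inE //; [exact: bigcapT_measurable|exact: bigcap_inf].
  apply: le_trans (maximal_inequality_sup (c := (d * e ^+ 2 / (vr + 1))%R) (agT T) e0 _) _.
    move=> t; have [tT|Tt] := leqP t T.
      rewrite big_nat_cond big1 ?lee_fin.
        by rewrite divr_ge0 ?mulr_ge0 ?exprn_ge0 //; lra.
      move=> s /andP[/andP[_ st] _]; apply: integral0_eq => w _.
      by rewrite /gT leqNgt (leq_trans st tT) /= expr0n.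
    rewrite (big_cat_nat (n := T)) //=; last exact: ltnW.
    rewrite big_nat_cond big1 ?add0e; last first.
      move=> s /andP[/andP[_ st] _]; apply: integral0_eq => w _.
      by rewrite /gT leqNgt st /= expr0n.
    rewrite (eq_big_nat _ _ (F2 := fun s => (B s)%:E)) => [|s /andP[Ts _]].
      by rewrite sumEFin lee_fin.
    by rewrite -BE; apply: eq_integral => w _; rewrite /gT Ts.
  rewrite vE -!EFinM lee_fin.
  have -> : ((e ^+ 2)^-1 * (vr * (d * e ^+ 2 / (vr + 1))) = d * (vr / (vr + 1)))%R.
    have en0 : e != 0%R by rewrite gt_eqF.
    have vn0 : (vr + 1 != 0)%R by rewrite gt_eqF //; lra.
    by field; rewrite en0 vn0.
  by rewrite ler_piMr ?(ltW d0) // ler_pdivrMr; lra.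
have : P.-negligible (\bigcup_j \bigcap_T D (j.+1%:R^-1)%R T).
  apply: negligible_bigcup => j; apply/negligibleP; first exact: bigcapT_measurable.
  by apply: PD; rewrite invr_gt0 ltr0n.
apply: negligibleS => w /= ncvg; apply: contrapT => nD; apply: ncvg.
apply/cauchy_cvgP/cauchy_exP => e e0.
have [j je] : exists j, (j.+1%:R^-1 < e)%R.
  have c0 : (0 <= e^-1)%R by rewrite invr_ge0 ltW.
  exists (Num.bound e^-1); rewrite invf_plt ?posrE ?ltr0n //.
  by apply: lt_le_trans (archi_boundP c0) _; rewrite ler_nat.
have [T hT] : exists T, ~ D (j.+1%:R^-1)%R T w.
  apply: contrapT => /forallNP h'; apply: nD; exists j => // T _.
  exact: contrapT (h' T).
exists (partial_sum g T w); exists T => // t /= Tt.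
rewrite /ball /= -/(partial_sum g t w).
apply: le_lt_trans je; rewrite leNgt; apply/negP => ex; apply: hT; exists t => //.
suff <- : (partial_sum g t w - partial_sum g T w = partial_sum (gT T) t w)%R.
  by rewrite distrC.
rewrite /partial_sum /series /= (big_cat_nat (n := T)) //= [RHS](big_cat_nat (n := T)) //=.
rewrite [in RHS]big_nat_cond [in RHS]big1 ?add0r => [|s /andP[/andP[_ sT] _]]; last first.
  by rewrite /gT leqNgt sT /= mul0r.
rewrite addrAC subrr add0r; apply: eq_big_nat => s /andP[Ts _].
by rewrite /gT Ts.
Qed.

End Isometry.
End Past.

(** * Almost sure convergence of the compensated series *)

Section RobbinsMonro.
Context {R : realType} {disp : measure_display} {Omega : measurableType disp}.
Variable P : probability Omega R.
Context {d' : measure_display} {S : measurableType d'}.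
Variable X : nat -> Omega -> S.
Hypothesis mX : forall t, (1 <= t)%N -> measurable_fun setT (X t).
Hypothesis indX : mutually_independent P [set t | (1 <= t)%N] X.
Hypothesis idX : identically_distributed P [set t | (1 <= t)%N] X.
Variable alpha : nat -> Omega -> R.
Hypothesis alpha_adapted : forall t, adapted X t (alpha t).
Hypothesis alpha2 :
  {ae P, forall w, (\sum_(0 <= t <oo) (alpha t w ^+ 2)%:E < +oo)%E}.
Local Open Scope ereal_scope.

Lemma ge0_integral_identical t (f : S -> \bar R) : (1 <= t)%N ->
  measurable_fun setT f -> (forall x, 0 <= f x) ->
  \int[P]_w f (X t w) = \int[P]_w f (X 1%N w).
Proof.
move=> t1 mf f0.
pose Xt : {mfun Omega >-> S} := HB.pack (X t) (isMeasurableFun.Build _ _ _ _ (X t) (mX t1)).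
pose X1 : {mfun Omega >-> S} :=
  HB.pack (X 1%N) (isMeasurableFun.Build _ _ _ _ (X 1%N) (mX (leqnn 1))).
have := @ge0_integral_distribution _ _ _ _ _ P Xt f mf f0.
have := @ge0_integral_distribution _ _ _ _ _ P X1 f mf f0.
rewrite /comp /= => <- <-; apply: eq_measure_integral => A mA _.
exact: (idX t1 (leqnn 1) mA).
Qed.

Lemma integral_identical t (f : S -> R) : (1 <= t)%N -> measurable_fun setT f ->
  \int[P]_w (f (X t w))%:E = \int[P]_w (f (X 1%N w))%:E.
Proof.
move=> t1 mf; have mf' : measurable_fun setT (EFin \o f) by exact/measurable_EFinP.
change (\int[P]_w ((EFin \o f) \o X t) w = \int[P]_w ((EFin \o f) \o X 1%N) w).
rewrite integralE [RHS]integralE.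
rewrite [((EFin \o f) \o X t)^\+]funepos_comp [((EFin \o f) \o X 1%N)^\+]funepos_comp.
rewrite [((EFin \o f) \o X t)^\-]funeneg_comp [((EFin \o f) \o X 1%N)^\-]funeneg_comp.
congr (_ - _).
  exact: ge0_integral_identical t1 (measurable_funepos mf') _.
exact: ge0_integral_identical t1 (measurable_funeneg mf') _.
Qed.

(** The step sizes are switched off when the sum of their squares exceeds a
    level; almost every path agrees with the truncation at some level. *)
Lemma square_summable_cvg (h : S -> R) (mu : R) :
  measurable_fun setT h ->
  (forall t, \int[P]_w (h (X t.+1 w) - mu)%:E = 0) ->
  (forall t, \int[P]_w ((h (X t.+1 w) - mu) ^+ 2)%:E =
     \int[P]_w ((h (X 1%N w) - mu) ^+ 2)%:E) ->
  \int[P]_w ((h (X 1%N w) - mu) ^+ 2)%:E < +oo ->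
  {ae P, forall w, compensated (alpha ^~ w) (fun t => h (X t.+1 w)) mu}.
Proof.
move=> mh Z0 Zv Zoo.
pose A C s := [set w | (series (fun r => alpha r w ^+ 2) s.+1 <= C)%R].
pose beta (C : nat) s w := (alpha s w * \1_(A C%:R s) w)%R.
have abeta C s : adapted X s (beta C s).
  apply/adaptedP; apply: measurable_funM; first exact/adaptedP.
  apply: measurable_indic; rewrite -[X in measurable X]setTI.
  apply: measurable_fun_le => //.
  rewrite (_ : (fun w => _) = fun w => \sum_(r < s.+1) alpha r w ^+ 2)%R; last first.
    by apply/funext => w; rewrite /series /= big_mkord.
  apply: measurable_sum => r; apply: measurable_funX.
  apply/adaptedP; apply: (adapted_le (s := r)); first by rewrite -ltnS.
  exact: alpha_adapted.
have betaC (C : nat) w t : (series (fun s => beta C s w ^+ 2) t <= C%:R)%R.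
  suff : (series (fun s => beta C s w ^+ 2) t <=
    Num.min C%:R (series (fun r => alpha r w ^+ 2) t))%R.
    by rewrite le_min => /andP[].
  elim: t => [|t]; first by rewrite /series /= !big_geq // le_min ler0n lexx.
  rewrite !seriesSr !le_min => /andP[h1 h2]; rewrite {2 4}/beta indicE.
  have a0 := sqr_ge0 (alpha t w).
  have [tA|tA] := boolP (w \in A C%:R t).
    by move: tA; rewrite inE /A /= seriesSr mulr1 => h3; apply/andP; split; lra.
  by rewrite mulr0 expr0n /= addr0; apply/andP; split; lra.
have /ae_foralln hC C : {ae P, forall w,
    cvgn (series (fun s => beta C s w * (h (X s.+1 w) - mu))%R)}.
  exact: (series_square_cvg mX indX mh Z0 Zv Zoo (abeta C) (betaC C)).
move: hC alpha2; apply: filterS2 => w hw hoo.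
have [C hwC] : exists C : nat, forall t, (series (fun r => alpha r w ^+ 2) t <= C%:R)%R.
  have s0 : 0 <= \sum_(0 <= t <oo) (alpha t w ^+ 2)%:E.
    by apply: nneseries_ge0 => t _ _; rewrite lee_fin sqr_ge0.
  have fin : \sum_(0 <= t <oo) (alpha t w ^+ 2)%:E \is a fin_num.
    by rewrite ge0_fin_numE.
  have c0 := fine_ge0 s0; exists (Num.bound (fine (\sum_(0 <= t <oo) (alpha t w ^+ 2)%:E))).
  move=> t; apply: le_trans (ltW (archi_boundP c0)).
  rewrite -lee_fin fineK // -sumEFin.
  by apply: nneseries_lim_ge => k _ _; rewrite lee_fin sqr_ge0.
rewrite /compensated.
suff -> : (fun t => alpha t w * (h (X t.+1 w) - mu))%R =
  (fun s => beta C s w * (h (X s.+1 w) - mu))%R by exact: hw.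
by apply/funext => s; rewrite /beta indicE mem_set ?mulr1 // /A /=; exact: hwC.
Qed.

Lemma compensated_ae (h : S -> R) : measurable_fun setT h ->
  \int[P]_w (h (X 1%N w) ^+ 2)%:E < +oo ->
  {ae P, forall w, compensated (alpha ^~ w) (fun t => h (X t.+1 w))
    (fine (\int[P]_w (h (X 1%N w))%:E))}.
Proof.
move=> mh h2oo; set mu := fine _.
have mh1 : measurable_fun setT (fun w => h (X 1%N w)).
  by apply: measurableT_comp => //; apply: mX.
have i1 (c : R) : P.-integrable setT (fun w => c%:E : \bar R).
  exact: finite_measure_integrable_cst.
have ih2 : P.-integrable setT (fun w => (h (X 1%N w) ^+ 2)%:E).
  apply/integrableP; split; first exact/measurable_EFinP/measurable_funX.
  rewrite (eq_integral (fun w => (h (X 1%N w) ^+ 2)%:E)) // => w _.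
  by rewrite gee0_abs // lee_fin sqr_ge0.
have ih : P.-integrable setT (fun w => (h (X 1%N w))%:E).
  apply: (le_integrable _ _ _ (integrableD measurableT (i1 1%R) ih2)) => //.
    exact/measurable_EFinP.
  move=> w _; change (`|(h (X 1%N w))%:E| <= `|(1 + h (X 1%N w) ^+ 2)%R%:E|).
  rewrite !abse_EFin lee_fin.
  rewrite (@ger0_norm _ (1 + _)%R) ?addr_ge0 ?sqr_ge0 //.
  have := sqr_ge0 (h (X 1%N w) - 1); have := sqr_ge0 (h (X 1%N w) + 1).
  by rewrite ler_norml; lra.
have mhc : measurable_fun setT (fun x => h x - mu)%R by apply: measurable_funB.
apply: square_summable_cvg => //.
- move=> t; rewrite (integral_identical (t := t.+1) (f := fun x => (h x - mu)%R)) //.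
  under eq_integral do rewrite EFinB.
  rewrite integralB //.
  have := integral_cst P measurableT mu%:E; rewrite /= probability_setT mule1 => ->.
  by rewrite /mu fineK ?subee //; apply: integrable_fin_num.
- move=> t; apply: (ge0_integral_identical (f := fun x => ((h x - mu) ^+ 2)%:E)) => //.
    exact/measurable_EFinP/measurable_funX.
  by move=> x; rewrite lee_fin sqr_ge0.
- have i3 : P.-integrable setT (fun w => (2 : R)%:E * (h (X 1%N w) ^+ 2)%:E + (2 * mu ^+ 2)%:E).
    by apply: integrableD => //; apply: integrableZl.
  have := integrable_lty measurableT i3; apply: le_lt_trans.
  apply: ge0_le_integral => //.
  - by move=> w _; rewrite lee_fin sqr_ge0.
  - apply/measurable_EFinP/measurable_funX.
    exact: measurable_funB.
  - by apply: measurable_int i3.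
  - move=> w _; rewrite -EFinM -EFinD lee_fin.
    have := sqr_ge0 (h (X 1%N w) + mu); lra.
Qed.

End RobbinsMonro.

(** * The spectral norm *)

Section SpectralNorm.
Context {R : realType}.

Lemma enorm_ge0 p (x : 'cV[R]_p) : 0 <= enorm x.
Proof. exact: sqrtr_ge0. Qed.

Lemma entry_le_enorm p (x : 'cV[R]_p) i : `|x i 0| <= enorm x.
Proof.
rewrite /enorm -sqrtr_sqr ler_wsqrtr // (bigD1 i) //= lerDl.
by apply: sumr_ge0 => j _; apply: sqr_ge0.
Qed.

Lemma enorm_le_sum p (x : 'cV[R]_p) : enorm x <= \sum_i `|x i 0|.
Proof.
have s0 : 0 <= \sum_i `|x i 0| by apply: sumr_ge0.
rewrite /enorm -[leRHS](ger0_norm s0) -sqrtr_sqr ler_wsqrtr // expr2 mulr_suml.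
apply: ler_sum => i _; rewrite -real_normK ?num_real // expr2 ler_wpM2l //.
by rewrite (bigD1 i) //= lerDl; apply: sumr_ge0.
Qed.

Lemma enorm_mul_le p q (A : 'M[R]_(p, q)) x :
  enorm x <= 1 -> enorm (A *m x) <= \sum_i \sum_j `|A i j|.
Proof.
move=> x1; apply: le_trans (enorm_le_sum _) _; apply: ler_sum => i _.
rewrite mxE; apply: le_trans (ler_norm_sum _ _ _) _; apply: ler_sum => j _.
rewrite normrM ler_piMr //; exact: le_trans (entry_le_enorm _ _) x1.
Qed.

Lemma mxnorm2_has_sup p q (A : 'M[R]_(p, q)) :
  has_sup [set enorm (A *m x) | x in [set x : 'cV[R]_q | enorm x <= 1]].
Proof.
split.
  exists (enorm (A *m 0)); exists 0 => //=; rewrite /enorm big1 ?sqrtr0 // => i _.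
  by rewrite mxE expr0n.
by exists (\sum_i \sum_j `|A i j|) => _ [x x1 <-]; apply: enorm_mul_le.
Qed.

Lemma mxnorm2_ge0 p q (A : 'M[R]_(p, q)) : 0 <= mxnorm2 A.
Proof.
apply: (@le_trans _ _ (enorm (A *m 0))); first exact: enorm_ge0.
apply: ub_le_sup; first by case: (mxnorm2_has_sup A).
by exists 0 => //=; rewrite /enorm big1 ?sqrtr0 // => i _; rewrite mxE expr0n.
Qed.

Lemma mxnorm2_le_sum p q (A : 'M[R]_(p, q)) : mxnorm2 A <= \sum_i \sum_j `|A i j|.
Proof.
apply: ge_sup; first by case: (mxnorm2_has_sup A).
by move=> _ [x x1 <-]; apply: enorm_mul_le.
Qed.

Lemma entry_le_mxnorm2 p q (A : 'M[R]_(p, q)) i j : `|A i j| <= mxnorm2 A.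
Proof.
have e1 : enorm (delta_mx j 0 : 'cV[R]_q) <= 1.
  rewrite /enorm (bigD1 j) //= big1 => [|k kj].
    by rewrite mxE !eqxx expr1n addr0 sqrtr1.
  by rewrite mxE (negbTE kj) expr0n.
have : enorm (A *m (delta_mx j 0 : 'cV[R]_q)) <= mxnorm2 A.
  by apply: ub_le_sup; [case: (mxnorm2_has_sup A)|exists (delta_mx j 0)].
apply: le_trans; have := entry_le_enorm (A *m (delta_mx j 0 : 'cV[R]_q)) i.
by rewrite -colE mxE.
Qed.

Lemma psd_mxnorm2_le d (A : 'M[R]_d) : psdmx A -> mxnorm2 A <= (d ^ 2)%:R * \tr A.
Proof.
move=> pA; apply: le_trans (mxnorm2_le_sum A) _.
apply: (@le_trans _ _ (\sum_(i < d) \sum_(j < d) \tr A)).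
  by apply: ler_sum => i _; apply: ler_sum => j _; apply: psd_entry_le_tr.
by rewrite !sumr_const !card_ord -mulrnA mulnn mulr_natl.
Qed.

Lemma tr_le_mxnorm2 d (A : 'M[R]_d) : \tr A <= d%:R * mxnorm2 A.
Proof.
rewrite mulr_natl -[X in _ *+ X]card_ord -sumr_const; apply: ler_sum => i _.
exact: le_trans (ler_norm _) (entry_le_mxnorm2 _ _ _).
Qed.

Lemma mul_entries_le_mxnorm2 n d (L : 'M[R]_(n, d)) p q i j :
  `|L p i * L q j| <= mxnorm2 (L^T *m L).
Proof.
have D k r : L r k ^+ 2 <= mxnorm2 (L^T *m L).
  apply: le_trans (le_trans (ler_norm _) (entry_le_mxnorm2 (L^T *m L) k k)).
  rewrite mxE (bigD1 r) //= mxE -expr2 lerDl; apply: sumr_ge0 => s _.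
  by rewrite mxE -expr2 sqr_ge0.
have := D i p; have := D j q.
have := sqr_ge0 (L p i - L q j); have := sqr_ge0 (L p i + L q j).
rewrite ler_norml; lra.
Qed.

End SpectralNorm.

Lemma bounded_trace {R : realType} d (Q : nat -> 'M[R]_d) :
  (forall t, psdmx (Q t)) ->
  (exists M : R, forall t, mxnorm2 (Q t) <= M) <->
  (exists M : nat, forall t, \tr (Q t) <= M%:R).
Proof.
move=> pQ; split=> [[M hM]|[M hM]].
  have M0 : 0 <= d%:R * M.
    by rewrite mulr_ge0 // (le_trans _ (hM 0%N)) // mxnorm2_ge0.
  exists (Num.bound (d%:R * M)) => t.
  apply: le_trans (ltW (archi_boundP M0)); apply: le_trans (tr_le_mxnorm2 _) _.
  by rewrite ler_wpM2l.
exists ((d ^ 2)%:R * M%:R) => t; apply: le_trans (psd_mxnorm2_le (pQ t)) _.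
by rewrite ler_wpM2l.
Qed.

(** * Regular paths and the zero-one law *)

Section Coordinates.
Context {R : realType}.

Lemma measurable_coord p q i j :
  measurable_fun setT (fun A : borelmx R p q => (A : 'M[R]_(p, q)) i j).
Proof.
apply: (measurability _ (RGenOpens.measurableE R)) => _ [_ [x [y ->] <-]].
rewrite setTI; apply: sub_sigma_algebra.
have /continuousP := @coord_continuous R p q i j; apply.
exact: interval_open.
Qed.

(** The integral of a nonnegative function is a supremum over the simple
    functions below it, so it is monotone on all functions. *)
Lemma ge0_le_integral_any d (T : measurableType d) (mu : {measure set T -> \bar R})
    (f g : T -> \bar R) : (forall x, (0 <= f x)%E) -> (forall x, (f x <= g x)%E) ->
  (\int[mu]_x f x <= \int[mu]_x g x)%E.
Proof.
move=> f0 fg; rewrite !ge0_integralTE //; last by move=> x; apply: le_trans (fg x).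
apply: le_ereal_sup => _ [h hf <-]; exists h => // x.
exact: le_trans (hf x) (fg x).
Qed.

End Coordinates.

Lemma step_sizes_of_divergent {R : realType} (a : nat -> R) :
  (forall t, 0 <= a t <= 1) -> (\sum_(0 <= t <oo) (a t)%:E = +oo)%E -> step_sizes a.
Proof.
move=> a01 aoo; split=> // M; apply: contrapT => /forallNP aM.
have : (\sum_(0 <= t <oo) (a t)%:E <= M%:E)%E.
  apply: lime_le.
    by apply: is_cvg_nneseries => t _ _; rewrite lee_fin; have /andP[] := a01 t.
  near=> t; rewrite sumEFin lee_fin.
  by have /negP := aM t; rewrite -ltNge => /ltW.
by rewrite aoo.
Unshelve. all: by end_near.
Qed.

Section ZeroOne.
Context {R : realType} {n m : nat} {disp : measure_display}.
Context {Omega : measurableType disp} (P : probability Omega R).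
Variables (Lam : nat -> Omega -> 'M[R]_(n, n + m)) (N : nat -> Omega -> 'M[R]_(n + m)).
Variables (alpha : nat -> Omega -> R).
Hypothesis X_measurable : forall t, (1 <= t)%N -> measurable_fun setT (obs Lam N t).
Hypothesis N_psd : forall t w, (1 <= t)%N -> psdmx (N t w).
Hypothesis X_independent : mutually_independent P [set t | (1 <= t)%N] (obs Lam N).
Hypothesis X_identical : identically_distributed P [set t | (1 <= t)%N] (obs Lam N).
Hypothesis alpha_range : forall t w, 0 <= alpha t w <= 1.
Hypothesis alpha_adapted : forall t (B : set R), measurable B ->
  filtration (obs Lam N) t (alpha t @^-1` B).
Hypothesis alpha_sum : {ae P, forall w, (\sum_(0 <= t <oo) (alpha t w)%:E = +oo)%E}.
Hypothesis alpha_sum_sq :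
  {ae P, forall w, (\sum_(0 <= t <oo) (alpha t w ^+ 2)%:E < +oo)%E}.
Hypothesis moments : ('E_P[fun w => (mxnorm2 (N 1%N w) ^+ 2
  + mxnorm2 ((Lam 1%N w)^T *m Lam 1%N w) ^+ 2)%R] < +oo)%E.

Definition cross_moment (p q : 'I_n) : 'M[R]_(n + m) :=
  meanmx P (fun w => (row p (Lam 1%N w))^T *m row q (Lam 1%N w)).

Lemma moment_finite (f : Omega -> R) :
  (forall w, f w ^+ 2 <= mxnorm2 (N 1%N w) ^+ 2 +
     mxnorm2 ((Lam 1%N w)^T *m Lam 1%N w) ^+ 2) ->
  (\int[P]_w (f w ^+ 2)%:E < +oo)%E.
Proof.
move=> hf; apply: le_lt_trans moments; rewrite unlock.
apply: ge0_le_integral_any => w; first by rewrite lee_fin sqr_ge0.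
by rewrite lee_fin.
Qed.

(** Finitely many scalar series suffice, because for every [G] the entries of
    [Lam^T G Lam] are combinations of the products of two entries of [Lam].  Such
    a product is at most the norm of [Lam^T Lam], hence square integrable. *)
Lemma ae_regular_path : {ae P, forall w,
  [/\ step_sizes (alpha ^~ w),
      mx_compensated (alpha ^~ w) (fun t => N t.+1 w) (meanmx P (N 1%N)) &
      forall p q, mx_compensated (alpha ^~ w)
        (fun t => (row p (Lam t.+1 w))^T *m row q (Lam t.+1 w)) (cross_moment p q)]}.
Proof.
pose S : measurableType _ := (borelmx R n (n + m) * borelmx R (n + m) (n + m))%type.
have mN i j : measurable_fun setT (fun x : S => (x.2 : 'M[R]_(n + m)) i j).
  exact: measurableT_comp (measurable_coord i j) measurable_snd.
have mL p i : measurable_fun setT (fun x : S => (x.1 : 'M[R]_(n, n + m)) p i).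
  exact: measurableT_comp (measurable_coord p i) measurable_fst.
have sq_le (x y : R) : `|x| <= y -> x ^+ 2 <= y ^+ 2.
  move=> xy; rewrite -[leLHS]real_normK ?num_real // lerXn2r ?nnegrE //.
  exact: le_trans xy.
have hN : {ae P, forall w, forall ij : 'I_(n + m) * 'I_(n + m),
    compensated (alpha ^~ w) (fun t => N t.+1 w ij.1 ij.2)
      (meanmx P (N 1%N) ij.1 ij.2)}.
  apply: filter_forall => -[i j] /=; rewrite mxE unlock.
  apply: (compensated_ae X_measurable X_independent X_identical alpha_adapted
    alpha_sum_sq (mN i j)) => /=.
  apply: moment_finite => w; apply: le_trans (sq_le _ _ (entry_le_mxnorm2 (N 1%N w) i j)) _.
  by rewrite lerDl sqr_ge0.
have hL : {ae P, forall w, forall x : ('I_n * 'I_n) * ('I_(n + m) * 'I_(n + m)),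
    compensated (alpha ^~ w)
      (fun t => Lam t.+1 w x.1.1 x.2.1 * Lam t.+1 w x.1.2 x.2.2)
      (fine (\int[P]_w (Lam 1%N w x.1.1 x.2.1 * Lam 1%N w x.1.2 x.2.2)%:E)%E)}.
  apply: filter_forall => -[[p q] [i j]] /=.
  apply: (compensated_ae X_measurable X_independent X_identical alpha_adapted
    alpha_sum_sq (measurable_funM (mL p i) (mL q j))) => /=.
  apply: moment_finite => w.
  apply: le_trans (sq_le _ _ (mul_entries_le_mxnorm2 (Lam 1%N w) p q i j)) _.
  by rewrite lerDr sqr_ge0.
move: alpha_sum hN hL; apply: filterS3 => w asum wN wL; split.
- by apply: step_sizes_of_divergent.
- by move=> i j; exact: (wN (i, j)).
move=> p q i j; rewrite /cross_moment [X in compensated _ _ X]mxE unlock.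
have E w' t : ((row p (Lam t w'))^T *m row q (Lam t w')) i j =
    Lam t w' p i * Lam t w' q j by rewrite !mxE big_ord1 !mxE.
under eq_integral do rewrite E.
apply: eq_compensated (wL ((p, q), (i, j))) => t /=; by rewrite E.
Qed.

Variables (Q0 : 'M[R]_(n + m)) (Q : nat -> Omega -> 'M[R]_(n + m)).
Hypothesis mean_N_pd : pdmx (meanmx P (N 1%N)).
Hypothesis Q0_psd : psdmx Q0.
Hypothesis Q_init : forall w, Q 0%N w = Q0.
Hypothesis Q_step : forall t w, Q t.+1 w =
  Q t w + alpha t w *: (N t.+1 w + (Lam t.+1 w)^T *m Pi (Q t w) *m Lam t.+1 w - Q t w).

Lemma Q_psd t w : psdmx (Q t w).
Proof.
apply: (@qlearning_psd _ _ _ (alpha ^~ w) (fun t => Lam t.+1 w) (fun t => N t.+1 w)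
  (Q ^~ w)) => //.
- by move=> s; apply: N_psd.
- by rewrite Q_init.
Qed.

Lemma Q_measurable t : mx_measurable (Q t).
Proof.
have mL s : mx_measurable (Lam s.+1).
  move=> i j; apply: (measurableT_comp (measurable_coord i j)
    (measurableT_comp measurable_fst (X_measurable (ltn0Sn s)))).
have mN s : mx_measurable (N s.+1).
  move=> i j; apply: (measurableT_comp (measurable_coord i j)
    (measurableT_comp measurable_snd (X_measurable (ltn0Sn s)))).
elim: t => [|t IH].
  by rewrite (_ : Q 0%N = fun=> Q0); [exact: mx_measurable_cst|exact/funext].
rewrite (_ : Q t.+1 = fun w => Q t w + alpha t w *: (N t.+1 w +
  (Lam t.+1 w)^T *m Pi (Q t w) *m Lam t.+1 w - Q t w)); last exact/funext.
apply: mx_measurableD => //; apply: mx_measurableZ.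
  have ad : adapted (obs Lam N) t (alpha t) by move=> B0 mB0; apply: alpha_adapted.
  by move: (adapted_measurable X_measurable ad).
apply: mx_measurableB => //; apply: mx_measurableD => //.
apply: mx_measurableM => //; apply: mx_measurableM; first exact: mx_measurable_tr.
by apply: mx_measurable_Pi => // w; apply: Q_psd.
Qed.

End ZeroOne.

Theorem corollary1p2 (R : realType) (n m : nat) (hn : (1 <= n)%N) (hm : (1 <= m)%N)
    (disp : measure_display) (Omega : measurableType disp) (P : probability Omega R)
    (Lam : nat -> Omega -> 'M[R]_(n, n + m)) (N : nat -> Omega -> 'M[R]_(n + m))
    (alpha : nat -> Omega -> R)
    (Q0 : 'M[R]_(n + m)) (Q : nat -> Omega -> 'M[R]_(n + m))
    (X_measurable : forall t, (1 <= t)%N -> measurable_fun setT (obs Lam N t))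
    (N_psd : forall t w, (1 <= t)%N -> psdmx (N t w))
    (X_independent : mutually_independent P [set t | (1 <= t)%N] (obs Lam N))
    (X_identical : identically_distributed P [set t | (1 <= t)%N] (obs Lam N))
    (alpha_range : forall t w, 0 <= alpha t w <= 1)
    (alpha_adapted : forall t (B : set R), measurable B ->
       filtration (obs Lam N) t (alpha t @^-1` B))
    (alpha_sum : {ae P, forall w, (\sum_(0 <= t <oo) (alpha t w)%:E = +oo)%E})
    (alpha_sum_sq : {ae P, forall w, (\sum_(0 <= t <oo) (alpha t w ^+ 2)%:E < +oo)%E})
    (moments : ('E_P[fun w => (mxnorm2 (N 1%N w) ^+ 2
                       + mxnorm2 ((Lam 1%N w)^T *m Lam 1%N w) ^+ 2)%R] < +oo)%E)
    (mean_N_pd : pdmx (meanmx P (N 1%N)))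
    (Q0_psd : psdmx Q0)
    (Q_init : forall w, Q 0%N w = Q0)
    (Q_step : forall t w, Q t.+1 w =
       Q t w + alpha t w *: (N t.+1 w + (Lam t.+1 w)^T *m Pi (Q t w) *m Lam t.+1 w
                             - Q t w)) :
  let bounded := [set w | exists M : R, forall t, mxnorm2 (Q t w) <= M] in
  P bounded = 0%E \/ P bounded = 1%E.
Proof.
set B := [set w | _].
have psd_Q t w : psdmx (Q t w) by apply: (Q_psd N_psd alpha_range Q0_psd Q_init Q_step).
have trB w : B w <-> exists M : nat, forall t, \tr (Q t w) <= M%:R.
  exact: bounded_trace.
have mB : measurable B.
  have -> : B = \bigcup_(M : nat) \bigcap_t [set w | \tr (Q t w) <= M%:R].
    apply/seteqP; split=> w.
      by move=> /trB[M hM]; exists M => // t _; apply: hM.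
    by move=> [M _ hM]; apply/trB; exists M => t; apply: hM.
  apply: bigcupT_measurable => M; apply: bigcapT_measurable => t.
  rewrite -[X in measurable X]setTI; apply: measurable_fun_le => //.
  apply: measurable_sum => i.
  exact: (Q_measurable X_measurable N_psd alpha_range alpha_adapted Q0_psd
    Q_init Q_step).
have Nw w t : psdmx (N t.+1 w) by exact: N_psd.
have aeP := ae_regular_path X_measurable X_independent X_identical alpha_range
  alpha_adapted alpha_sum alpha_sum_sq moments.
have [[S superS]|noS] :=
    pselect (exists S, supersolution (meanmx P (N 1%N)) (cross_moment P Lam) S);
    [right|left].
  have : {ae P, forall w, B w}.
    apply: filterS aeP => w [aS NH LT]; apply/trB.
    have [M hM] := supersolution_bounded aS (Nw w) NH LT mean_N_pd (psd_Q 0%N w)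
      (Q_step ^~ w) superS.
    have M0 : 0 <= M by apply: le_trans (hM 0%N); apply/psd_tr_ge0.
    exists (Num.bound M) => t; apply: le_trans (hM t) (ltW (archi_boundP M0)).
  rewrite /almost_everywhere /= => /negligibleP.
  rewrite -[[set w | B w]]/B => /(_ (measurableC mB)) PB.
  by have := probability_setC P (measurableC mB); rewrite setCK PB sube0.
apply/negligibleP => //; apply: negligibleS aeP => w /trB[M hM] [aS NH LT].
apply: noS.
have := bounded_supersolution aS (Nw w) NH LT mean_N_pd (psd_Q 0%N w) (Q_step ^~ w) hM.
by [].
Qed.
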